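(* Let $0<p<1$, $q=1-p$, $\frac12<a<1$ and $x\in\mathbb{R}_+=[0,\infty)$. Then $$\frac{n-L(\lfloor p^{-1}n-xn^a\rfloor,\,n)}{n^{2a-1}}\longrightarrow\frac{(px)^2}{4q}\quad\text{in probability as } n\to\infty.$$
   Context: Let $\{X_v\}_{v\in\mathbb{Z}^2}$ be independent Bernoulli random variables on a common probability space with $\mathbb{P}(X_v=1)=p=1-q$ and $\mathbb{P}(X_v=0)=q$. A site $v$ is called marked if $X_v=1$. For positive integers $m,n$, $L(m,n)$ denotes the maximal number of marked sites that can be collected along a path in the rectangle $\{1,\dots,m\}\times\{1,\dots,n\}$ that is strictly increasing in both coordinates; that is, $L(m,n)$ is the largest $k\ge 0$ for which there exist marked sites $(i_1,j_1),\dots,(i_k,j_k)$ with $1\le i_1<i_2<\dots<i_k\le m$ and $1\le j_1<j_2<\dots<j_k\le n$. The quantity $L(\lfloor p^{-1}n-xn^a\rfloor,n)$ is considered for $n$ large enough that $\lfloor p^{-1}n-xn^a\rfloor\ge1$. *)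

(* Defs.v *)
From HB Require Import structures.
From mathcomp Require Export all_boot all_order all_algebra finmap.
From mathcomp Require Export all_classical all_reals all_analysis.

Set Implicit Arguments.
Unset Strict Implicit.
Unset Printing Implicit Defensive.

Export Order.TTheory GRing.Theory Num.Theory numFieldNormedType.Exports.

Global Open Scope classical_set_scope.
Global Open Scope ring_scope.

Definition mutually_independent d d' (T : measurableType d)
    (T' : measurableType d') (R : realType) (P : probability T R)
    (I : choiceType) (X : I -> {RV P >-> T'}) : Prop :=
  forall (J : {fset I}) (B : I -> set T'),
    (forall i, i \in J -> measurable (B i)) ->
    P (\bigcap_(i in [set` J]) (X i @^-1` B i)) =
    (\prod_(i <- J) P (X i @^-1` B i))%E.

Definition cvg_in_probability d (T : measurableType d) (R : realType)
    (P : probability T R) (Y : nat -> T -> R) (l : R) : Prop :=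
  forall eps : R, 0 < eps ->
    P [set w | eps < `|Y n w - l|] @[n --> \oo] --> 0%E.

Definition rectangle (m n : int) : pred (int * int) :=
  fun v => (1 <= v.1 <= m) && (1 <= v.2 <= n).

Definition strictly_below (u v : int * int) : bool :=
  (u.1 < v.1) && (u.2 < v.2).

Definition marked_path (marked : pred (int * int)) (m n : int)
    (s : seq (int * int)) : bool :=
  sorted strictly_below s && all (fun v => marked v && rectangle m n v) s.

Definition collectible (marked : pred (int * int)) (m n : int) : pred nat :=
  fun k => `[< exists2 s, marked_path marked m n s & size s = k >].

Lemma collectible_ex marked m n : exists k, collectible marked m n k.
Proof. by exists 0%N; apply/asboolP; exists [::]. Qed.

Lemma collectible_le marked m n k : collectible marked m n k -> (k <= `|m|)%N.
Proof.
move=> /asboolP[s /andP[s_sorted /allP s_in] <-].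
have sorted1 : sorted (fun i j : int => i < j) (map fst s).
  by rewrite sorted_map; apply: sub_sorted s_sorted => u v /andP[].
have uniq1 : uniq (map fst s).
  by apply: (sorted_uniq _ _ sorted1); [exact: lt_trans|exact: ltxx].
have -> : size s = size (map fst s) by rewrite size_map.
rewrite -(size_iota 1 `|m|) -(size_map Posz).
apply: uniq_leq_size => // i /mapP[v vs ->].
have /andP[_ /andP[/andP[v1 vm] _]] := s_in _ vs.
case: (v.1) v1 vm => // j j1; case: m {s_in} => // m' jm.
have Posz_inj : injective Posz by move=> ? ? [].
by rewrite mem_map // mem_iota add1n ltnS; apply/andP; split.
Qed.

(* For m <= 0 or n <= 0 the rectangle is empty and the value is 0. *)
Definition L (marked : pred (int * int)) (m n : int) : nat :=
  ex_maxn (collectible_ex marked m n) (@collectible_le marked m n).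

(* Main.v *)
Require Import Defs.
From mathcomp Require Import zify ring lra.

(* The increments of the last-passage height with Bernoulli boundary bits on the
   bottom (density u) and on the left (density v) are stationary as soon as
   u v = p (1 - u) (1 - v), and tilting one boundary then gives the moment
   generating function of the height in closed form. With 1 - v = om n^(a-1),
   the exponential rate of the height minus n, in units of n^(2a-1), is to first
   order -t (p x om - q om^2), which is -t (p x)^2 / (4 q) at the optimal
   om1 = p x / (2 q).
   Since boundaries only increase the height, this bounds L from above.
   For the lower bound take om slightly above om1: the path of the model with
   boundaries then cannot leave through the left boundary, nor through the
   bottom beyond a small multiple of n^a, because models with other densities
   dominate these constrained paths and have a strictly larger deficit. Hence
   L differs from the stationary height by at most a small number of boundary
   bits. *)
Set Implicit Arguments.
Unset Strict Implicit.
Unset Printing Implicit Defensive.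

(** * Last-passage recursion *)

Definition scons A (x : A) (g : nat -> A) (k : nat) : A :=
  if k is k'.+1 then g k' else x.

(* The heights to the right of the column of heights [H], from the bottom value
   [s]; [lpp S V xi i j] is the height at [(i, j)] for boundary heights [S] on
   the bottom and [V] on the left. *)
Fixpoint column (s : nat) (H : nat -> nat) (xi : nat -> bool) (j : nat) : nat :=
  if j is j'.+1 then
    maxn (maxn (column s H xi j') (H j'.+1)) (H j' + xi j')
  else s.

Fixpoint lpp (S V : nat -> nat) (xi : nat -> nat -> bool) (i : nat) :
    nat -> nat :=
  if i is i'.+1 then column (S i'.+1) (lpp S V xi i') (xi i') else V.

Fixpoint count_bits (b : nat -> bool) (k : nat) : nat :=
  if k is k'.+1 then (count_bits b k' + b k')%N else 0%N.

Lemma count_bits_scons b g k : count_bits (scons b g) k.+1 = (b + count_bits g k)%N.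
Proof.
elim: k => [|k IH]; first by rewrite /= addn0.
by rewrite -[LHS]/(count_bits (scons b g) k.+1 + g k)%N IH -addnA.
Qed.

Lemma count_bits_add b z k :
  count_bits b (z + k) = (count_bits b z + count_bits (fun i => b (z + i)%N) k)%N.
Proof. by elim: k => [|k IH]; rewrite ?addn0 // addnS /= IH addnA. Qed.

Lemma leq_count_bits (b c : nat -> bool) k :
  (forall i, b i <= c i)%N -> (count_bits b k <= count_bits c k)%N.
Proof. by move=> bc; elim: k => //= k IH; rewrite leq_add. Qed.

Lemma lppS S V xi i j :
  lpp S V xi i.+1 j.+1 =
  maxn (maxn (lpp S V xi i.+1 j) (lpp S V xi i j.+1)) (lpp S V xi i j + xi i j).
Proof. by []. Qed.

Lemma leq_column s s' H H' xi j :
  (s <= s')%N -> (forall k, H k <= H' k)%N -> (column s H xi j <= column s' H' xi j)%N.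
Proof.
move=> ss HH; elim: j => //= j IH.
by rewrite !geq_max !leq_max IH (HH j.+1) leq_add2r HH !orbT.
Qed.

Lemma leq_lpp S S' V V' xi i j :
  (forall k, S k <= S' k)%N -> (forall k, V k <= V' k)%N ->
  (lpp S V xi i j <= lpp S' V' xi i j)%N.
Proof.
by move=> SS VV; elim: i j => [|i IH] j; [exact: VV | exact: leq_column].
Qed.

Lemma lpp_shift c S V xi i j :
  lpp (fun k => c + S k)%N (fun k => c + V k)%N xi i j = (c + lpp S V xi i j)%N.
Proof.
elim: i j => [//|i IH] j; elim: j => [//|j IHj].
by rewrite !lppS IHj !IH; lia.
Qed.

(** The recursion removes the last column, whereas the stationarity argument consumes the first one,
    whose heights become the new left boundary. *)
Lemma lpp_front S V xi i j :
  lpp S V xi i.+1 j =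
  lpp (fun k => S k.+1) (column (S 1%N) V (xi 0%N)) (fun k => xi k.+1) i j.
Proof.
elim: i j => [//|i IH] j; elim: j => [//|j IHj].
by rewrite lppS [RHS]lppS IHj !IH.
Qed.

Lemma eq_lpp S V xi xi' m n :
  (forall i j, (i < m)%N -> (j < n)%N -> xi i j = xi' i j) ->
  lpp S V xi m n = lpp S V xi' m n.
Proof.
elim: m n => [//|m IHm] n; elim: n => [//|n IHn] e.
rewrite !lppS IHn ?IHm ?e // => i j im jn; apply: e; lia.
Qed.

(** No path collects from both boundaries. In the recursion, maxima and additions of cell values
    preserve a bound by a maximum. *)
Lemma lpp_boundary_max S V xi i j :
  (lpp S V xi i j <= maxn (lpp S (fun=> 0) xi i j) (lpp (fun=> 0) V xi i j))%N.
Proof.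
elim: i j => [|i IH] j; first by rewrite leq_maxr.
elim: j => [|j IHj]; first by rewrite leq_maxl.
by rewrite !lppS; have := IH j; have := IH j.+1; lia.
Qed.

(* An optimal path leaves the bottom boundary either within the first [z]
   columns, and then gains at most [count_bits b z] over [lpp] without
   boundary, or later, and then it only sees the remaining columns. *)
Lemma lpp_exit b xi z k n :
  (lpp (count_bits b) (fun=> 0) xi (z + k) n <=
   count_bits b z +
   maxn (lpp (fun=> 0) (fun=> 0) xi (z + k) n)
        (lpp (count_bits (fun i => b (z + i)%N)) (fun=> 0)
             (fun i => xi (z + i)%N) k n))%N.
Proof.
(* The bottom boundary with its first [z] bits erased: flat up to column [z], then counting the
   later bits only. *)
pose S i := (count_bits b (maxn i z) - count_bits b z)%N.
have mono i j : (i <= j)%N -> (count_bits b i <= count_bits b j)%N.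
  by move=> /subnK <-; rewrite addnC count_bits_add leq_addr.
have S_z i : (i <= z)%N -> S i = 0%N by move=> iz; rewrite /S (maxn_idPr iz) subnn.
have S_add i : S (z + i)%N = count_bits (fun i => b (z + i)%N) i.
  by rewrite /S (maxn_idPl (leq_addr _ _)) count_bits_add addKn.
have shiftS : (lpp (count_bits b) (fun=> 0) xi (z + k) n <=
              count_bits b z + lpp S (fun=> 0) xi (z + k) n)%N.
  rewrite -lpp_shift; apply: leq_lpp => // i; rewrite /S.
  have := mono i _ (leq_maxl i z); lia.
apply: leq_trans shiftS _; rewrite leq_add2l.
have base i j : (i <= z)%N -> lpp S (fun=> 0) xi i j = lpp (fun=> 0) (fun=> 0) xi i j.
  elim: i j => [//|i IH] j iz; elim: j => [|j IHj]; first exact: S_z.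
  by rewrite !lppS IHj !IH // ltnW.
elim: k n => [|k IH] n; first by rewrite addn0 base // leq_maxl.
rewrite addnS; elim: n => [|n IHn].
  by rewrite /= -addnS S_add leq_maxr.
rewrite !lppS; have := IH n; have := IH n.+1; lia.
Qed.

(** * Increasing paths of marked sites *)

Section paths.
Variables (marked : pred (int * int)).
(** Cells are numbered from 0 and sites from 1: the cell [(i, j)] carries the site
    [(i.+1, j.+1)]. *)
Let xi i j := marked (i.+1%:Z, j.+1%:Z).
Let G := lpp (fun=> 0%N) (fun=> 0%N) xi.

Let Gi0 i : G i 0 = 0%N. Proof. by case: i. Qed.

Let G_mono i i' j j' : (i <= i')%N -> (j <= j')%N -> (G i j <= G i' j')%N.
Proof.
have G1 i1 j1 : (G i1 j1 <= G i1.+1 j1)%N.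
  by case: j1 => [|j1]; rewrite ?Gi0 // /G lppS !leq_max leqnn !orbT.
have G2 i1 j1 : (G i1 j1 <= G i1 j1.+1)%N.
  by case: i1 => [//|i1]; rewrite /G lppS !leq_max leqnn.
move=> ii jj; apply: (@leq_trans (G i' j)).
  rewrite -(subnK ii); elim: (_ - _)%N => // k IH.
  by rewrite addSn; apply: leq_trans IH (G1 _ _).
rewrite -(subnK jj); elim: (_ - _)%N => // k IH.
by rewrite addSn; apply: leq_trans IH (G2 _ _).
Qed.

(** Induction on the last site [(i.+1, j.+1)] of the path: the earlier sites are strictly smaller in
    both coordinates, hence lie in the [i] by [j] rectangle, and [G] gains one across the marked
    cell [(i, j)]. *)
Lemma marked_path_leq_lpp (m n : nat) s :
  marked_path marked m n s -> (size s <= G m n)%N.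
Proof.
elim/last_ind: s m n => [//|s v IH] m n /andP[srt al].
have : v \in rcons s v by rewrite mem_rcons mem_head.
move=> /(allP al)/andP[]; move=> mk /andP[/andP[v1 v1m] /andP[v2 v2n]].
have [i ei] : exists i, v.1 = i.+1%:Z by case: v.1 v1 => [[|i]|i] // _; exists i.
have [j ej] : exists j, v.2 = j.+1%:Z by case: v.2 v2 => [[|j]|j] // _; exists j.
have ev : v = (i.+1%:Z, j.+1%:Z) by rewrite -ei -ej -surjective_pairing.
rewrite {}ev {v v1 v2 ei ej} in srt al mk v1m v2n *.
have im : (i < m)%N by [].
have jn : (j < n)%N by [].
have tr : transitive strictly_below.
  move=> a b c /andP[h1 h2] /andP[h3 h4].
  by rewrite /strictly_below (lt_trans h1 h3) (lt_trans h2 h4).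
have sb u : u \in s -> strictly_below u (i.+1%:Z, j.+1%:Z).
  move: srt; rewrite -cats1 => srt us.
  have := srt; rewrite sorted_pairwise // pairwise_cat allrelC /=.
  by move=> /andP[/andP[/allP/(_ _ us) ->]].
rewrite size_rcons; apply: leq_trans (G_mono im jn).
rewrite /G lppS !leq_max; apply/orP; right.
rewrite /xi mk addn1 ltnS; apply: IH; apply/andP; split.
  by move: srt; rewrite -cats1 => /cat_sorted2[].
apply/allP => u us; have := sb _ us => /andP[/= ui uj].
have : u \in rcons s (i.+1%:Z, j.+1%:Z) by rewrite mem_rcons inE us orbT.
move=> /(allP al)/andP[-> /andP[/andP[u1 _] /andP[u2 _]]] /=.
by rewrite /rectangle u1 u2 -!ltzD1 -![_%:Z + 1]/((_ + 1)%N%:Z) !addn1 ui uj.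
Qed.

(** Traces the recursion back: an optimal path is inherited from whichever of the three terms
    attains the maximum, and is extended by the corner site when this is the diagonal term of a
    marked cell. *)
Lemma marked_path_lpp (m n : nat) :
  exists2 s, marked_path marked m n s & size s = G m n.
Proof.
have weak (m' n' k l : nat) s : (m' <= k)%N -> (n' <= l)%N ->
    marked_path marked m' n' s -> marked_path marked k l s.
  move=> mk nl /andP[srt /allP al]; rewrite /marked_path srt; apply/allP => u us.
  have /andP[-> /andP[/andP[u1 um] /andP[u2 un]]] := al _ us.
  by rewrite /= /rectangle u1 u2 (le_trans um) ?(le_trans un).
elim: m n => [|m IHm] n; first by exists [::].
elim: n => [|n [s sp sz]]; first by exists [::].
rewrite /G lppS -/G.
have [le1|lt1] := leqP (maxn (G m.+1 n) (G m n.+1)) (G m n + xi m n)%N; last first.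
  have [le2|lt2] := leqP (G m n.+1) (G m.+1 n).
    by exists s => //; apply: weak sp.
  by have [s' sp' sz'] := IHm n.+1; exists s' => //; apply: weak sp'.
have [s' sp' sz'] := IHm n.
have [mk|_] := boolP (xi m n); last by exists s'; [apply: weak sp'|rewrite addn0].
exists (rcons s' (m.+1%:Z, n.+1%:Z)); last by rewrite size_rcons sz' addn1.
move: sp' => /andP[srt /allP al].
apply/andP; split.
  case: s' srt al {sz'} => [|u s'] srt al; first by [].
  rewrite /= in srt *.
  rewrite rcons_path srt /=; have := al _ (mem_last u s').
  move=> /andP[_ /andP[/andP[_ h1] /andP[_ h2]]].
  by rewrite /strictly_below /= (le_lt_trans h1) ?(le_lt_trans h2) ?ltz_nat ?ltnS.
rewrite all_rcons -/(xi m n) /= mk /= {1}/rectangle /=; apply/andP; split.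
  by rewrite !lexx.
apply/allP => u us; have /andP[-> /andP[/andP[u1 um] /andP[u2 un]]] := al _ us.
by rewrite /= /rectangle u1 u2 (le_trans um) ?(le_trans un) // lez_nat.
Qed.

Lemma L_lpp (m n : nat) : L marked m n = G m n.
Proof.
rewrite /L; case: ex_maxnP => k /asboolP[s sp <-] kmax.
apply/eqP; rewrite eqn_leq marked_path_leq_lpp //=; apply: kmax.
by apply/asboolP; have [t] := marked_path_lpp m n; exists t.
Qed.

End paths.

(* Along a column started with the bottom increment [b] and fed with the left
   increments [J], [hbit] is the horizontal increment at height [j] and [vbit]
   is the new vertical increment. *)
Fixpoint hbit (b : bool) (J x : nat -> bool) (j : nat) : bool :=
  if j is j'.+1 then ~~ J j' && (hbit b J x j' || x j') else b.

Definition vbit b J x j := ~~ hbit b J x j && (J j || x j).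

(** A cell with bottom increment [b], left increment [a] and mark [y] has top increment
    [~~ a && (b || y)] and right increment [~~ b && (a || y)]. Treating the bottom cell first leaves
    the same problem for the rest of the column. *)
Lemma hbit_scons b a y J x j :
  hbit b (scons a J) (scons y x) j.+1 = hbit (~~ a && (b || y)) J x j.
Proof. by elim: j => //= j ->. Qed.

Lemma vbit_scons b a y J x :
  vbit b (scons a J) (scons y x) =
  scons (~~ b && (a || y)) (vbit (~~ a && (b || y)) J x).
Proof.
by apply/funext => -[//|j]; rewrite /vbit hbit_scons.
Qed.

(** Compares the new column with the old one at the same height, while [column_vbit] reads it
    upwards from its own base. A column with bit increments thus produces another one, so that
    columns can be iterated. *)
Lemma column_hbit (b : bool) J x j :
  column b (count_bits J) x j = (count_bits J j + hbit b J x j)%N.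
Proof.
elim: j => //= j ->.
by case: (hbit _ _ _ _); case: (J j); case: (x j) => /=; lia.
Qed.

Lemma column_vbit (b : bool) J x j :
  column b (count_bits J) x j = (b + count_bits (vbit b J x) j)%N.
Proof.
elim: j => [|j IH]; first by rewrite /= addn0.
move: (IH); rewrite [in RHS]/= addnA -IH !column_hbit /vbit /=.
by case: (hbit _ _ _ _); case: (J j); case: (x j) => /=; lia.
Qed.

(** * Burke property and the exact moment generating function *)

Section expectation.
Variable R : realType.

(** A law is a finite list of weighted outcomes, so that expectations are finite sums and Fubini is
    an exchange of sums. *)
Definition expect A (d : seq (R * A)) (f : A -> R) : R :=
  \sum_(x <- d) x.1 * f x.2.

Definition is_dist A (d : seq (R * A)) :=
  all (fun x => 0 <= x.1) d /\ expect d (fun=> 1) = 1.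

Definition bernoulli (u : R) : seq (R * bool) := [:: (u, true); (1 - u, false)].

(** A sample of length [n] is an infinite sequence equal to [a0] from index [n] on, which is the
    shape of the arguments of [lpp]. *)
Fixpoint iid A (a0 : A) (d : seq (R * A)) (n : nat) : seq (R * (nat -> A)) :=
  if n is n'.+1 then
    [seq (x.1 * y.1, scons x.2 y.2) | x <- d, y <- iid a0 d n']
  else [:: (1, fun=> a0)].

Lemma eq_expect A (d : seq (R * A)) f g : f =1 g -> expect d f = expect d g.
Proof. by move=> fg; apply: eq_bigr => x _; rewrite fg. Qed.

Lemma expectZ A (d : seq (R * A)) c f :
  expect d (fun x => c * f x) = c * expect d f.
Proof. by rewrite /expect mulr_sumr; apply: eq_bigr => x _; rewrite mulrCA. Qed.

Lemma expectD A (d : seq (R * A)) f g :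
  expect d (fun x => f x + g x) = expect d f + expect d g.
Proof. by rewrite /expect -big_split; apply: eq_bigr => x _; rewrite mulrDr. Qed.

Lemma expectC A B (d : seq (R * A)) (e : seq (R * B)) f :
  expect d (fun x => expect e (fun y => f x y)) =
  expect e (fun y => expect d (fun x => f x y)).
Proof.
rewrite /expect; under eq_bigr do rewrite mulr_sumr.
rewrite exchange_big; apply: eq_bigr => y _; rewrite mulr_sumr.
by apply: eq_bigr => x _; rewrite mulrCA.
Qed.

Lemma expect_cst A (d : seq (R * A)) c : is_dist d -> expect d (fun=> c) = c.
Proof.
move=> [_ d1]; rewrite -[RHS]mulr1 -d1 -expectZ.
by apply: eq_expect => x; rewrite mulr1.
Qed.

Lemma le_expect A (d : seq (R * A)) f g :
  is_dist d -> (forall x, f x <= g x) -> expect d f <= expect d g.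
Proof.
move=> [d0 _] fg; rewrite /expect; elim: d d0 => [|x d IH] /=.
  by rewrite !big_nil.
by move=> /andP[x0 /IH le]; rewrite !big_cons lerD // ler_wpM2l.
Qed.

Lemma expect_ge0 A (d : seq (R * A)) f :
  is_dist d -> (forall x, 0 <= f x) -> 0 <= expect d f.
Proof. by move=> dd f0; rewrite -(expect_cst 0 dd); apply: le_expect. Qed.

Lemma expect_bernoulli u f :
  expect (bernoulli u) f = u * f true + (1 - u) * f false.
Proof. by rewrite /expect big_cons big_seq1. Qed.

Lemma bernoulli_dist u : 0 <= u <= 1 -> is_dist (bernoulli u).
Proof.
move=> /andP[u0 u1]; split; first by rewrite /= u0 subr_ge0 u1.
by rewrite expect_bernoulli; ring.
Qed.

Lemma expect_iid0 A a0 (d : seq (R * A)) f : expect (iid a0 d 0) f = f (fun=> a0).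
Proof. by rewrite /expect big_seq1 mul1r. Qed.

Lemma expect_iidS A a0 (d : seq (R * A)) n f :
  expect (iid a0 d n.+1) f =
  expect d (fun x => expect (iid a0 d n) (fun g => f (scons x g))).
Proof.
rewrite /expect /= big_allpairs_dep; apply: eq_bigr => x _.
by rewrite mulr_sumr; apply: eq_bigr => y _; rewrite mulrA.
Qed.

Lemma iid_dist A a0 (d : seq (R * A)) n : is_dist d -> is_dist (iid a0 d n).
Proof.
move=> dd; elim: n => [|n [n0 n1]].
  by split; [rewrite /= ler01 | rewrite expect_iid0].
split; last first.
  rewrite expect_iidS -[RHS](expect_cst 1 dd).
  by apply: eq_expect => x; rewrite n1.
case: dd => d0 _ /=; elim: d d0 (iid a0 d n) n0 {n1} => //= x d IH /andP[x0 d0] e e0.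
rewrite all_cat IH // andbT all_map; apply: sub_all e0 => y y0 /=.
exact: mulr_ge0.
Qed.

Lemma expect_iid_drop A a0 (d : seq (R * A)) z k (F : (nat -> A) -> R) :
  is_dist d ->
  expect (iid a0 d (z + k)) (fun g => F (fun i => g (z + i)%N)) =
  expect (iid a0 d k) F.
Proof.
move=> dd; elim: z => [//|z IH].
rewrite addSn expect_iidS -[RHS](expect_cst _ dd); apply: eq_expect => x.
exact: IH.
Qed.

(** The first [z] bits enter through their number only, and the other [k] bits are independent of
    them. *)
Lemma expect_count_split (d : seq (R * bool)) z k (F : nat -> (nat -> bool) -> R) :
  expect (iid false d (z + k)) (fun g => F (count_bits g z) (fun i => g (z + i)%N)) =
  expect (iid false d z) (fun g => expect (iid false d k) (F (count_bits g z))).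
Proof.
elim: z F => [|z IH] F; first by rewrite expect_iid0.
rewrite addSn !expect_iidS; apply: eq_expect => x.
under eq_expect do rewrite count_bits_scons.
rewrite (IH (fun c => F (x + c)%N)); apply: eq_expect => g.
by rewrite count_bits_scons.
Qed.

(** Raising a density moves mass from [false] to [true], which cannot decrease the mean of an
    increasing function. An induction on the bits takes the place of a coupling. *)
Lemma le_expect_bernoulli u u' n (f : (nat -> bool) -> R) :
  0 <= u -> u <= u' -> u' <= 1 ->
  (forall b c : nat -> bool, (forall i, b i -> c i) -> f b <= f c) ->
  expect (iid false (bernoulli u) n) f <= expect (iid false (bernoulli u') n) f.
Proof.
move=> u0 uu u1; elim: n f => [|n IH] f fmono; first by rewrite !expect_iid0.
rewrite !expect_iidS !expect_bernoulli.
pose e v b := expect (iid false (bernoulli v) n) (fun g => f (scons b g)).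
have mono b : e u b <= e u' b.
  by apply: IH => g h gh; apply: fmono => -[|i] //=; exact: gh.
have tf : e u false <= e u true.
  apply: le_expect => [|g]; first by apply/iid_dist/bernoulli_dist; lra.
  by apply: fmono => -[|i].
rewrite -/(e u true) -/(e u false) -/(e u' true) -/(e u' false).
have := mono true; have := mono false => m1 m2.
have h1 : u' * e u true <= u' * e u' true by rewrite ler_wpM2l //; lra.
have h2 : (1 - u') * e u false <= (1 - u') * e u' false by rewrite ler_wpM2l //; lra.
have h3 : 0 <= (u' - u) * (e u true - e u false) by rewrite mulr_ge0; lra.
nra.
Qed.

Lemma expect_exp_count t u n :
  expect (iid false (bernoulli u) n) (fun b => expR (t * (count_bits b n)%:R)) =
  (1 - u + u * expR t) ^+ n.
Proof.
elim: n => [|n IH]; first by rewrite expect_iid0 /= mulr0 expR0 expr0.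
rewrite expect_iidS exprS -IH.
have e b : expect (iid false (bernoulli u) n)
     (fun g => expR (t * (count_bits (scons b g) n.+1)%:R)) =
   expR (t * b%:R) * expect (iid false (bernoulli u) n)
     (fun g => expR (t * (count_bits g n)%:R)).
  rewrite -expectZ; apply: eq_expect => g.
  by rewrite count_bits_scons natrD mulrDr expRD.
rewrite expect_bernoulli [X in u * X]e [X in (1 - u) * X]e mulr1 mulr0 expR0 mul1r mulrA -mulrDl.
by rewrite (addrC (1 - u)).
Qed.

(** Exponential change of measure: the weight factorizes over the bits and, once normalized, turns
    the density [u'] into [u]. *)
Lemma expect_tilt t u u' n f :
  u * (1 - u' + u' * expR t) = u' * expR t ->
  1 - u' + u' * expR t != 0 ->
  expect (iid false (bernoulli u') n) (fun b => expR (t * (count_bits b n)%:R) * f b) =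
  (1 - u' + u' * expR t) ^+ n * expect (iid false (bernoulli u) n) f.
Proof.
set c := 1 - u' + _ => uE c0.
elim: n f => [|n IH] f.
  by rewrite !expect_iid0 /= mulr0 expR0 expr0.
rewrite !expect_iidS !expect_bernoulli.
have e b : expect (iid false (bernoulli u') n) (fun g =>
     expR (t * (count_bits (scons b g) n.+1)%:R) * f (scons b g)) =
   expR (t * b%:R) * (c ^+ n *
     expect (iid false (bernoulli u) n) (fun g => f (scons b g))).
  rewrite -IH -expectZ; apply: eq_expect => g.
  by rewrite count_bits_scons natrD mulrDr expRD mulrA.
have uE' : (1 - u) * c = 1 - u' by rewrite mulrBl uE mul1r /c addrK.
rewrite !e mulr1 mulr0 expR0 exprS mul1r.
set X := expect _ _; set Y := expect _ _.
transitivity (c ^+ n * (u * c * X + (1 - u) * c * Y)); last by ring.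
by rewrite uE uE'; ring.
Qed.

(** * Invariance of product Bernoulli increments *)

Section burke.
Variables p u v : R.
Hypothesis uv : u * v = p * (1 - u) * (1 - v).

(* Increments (1,0) and (0,1) go through a cell unchanged, (1,1) becomes (0,0),
   and (0,0) becomes (1,1) with probability [p]: [uv] balances the exchange. *)
Let cell f :
  expect (bernoulli u) (fun b => expect (bernoulli v) (fun a =>
    expect (bernoulli p) (fun y => f (~~ a && (b || y)) (~~ b && (a || y))))) =
  expect (bernoulli u) (fun b => expect (bernoulli v) (fun a => f b a)).
Proof.
rewrite !expect_bernoulli /=; apply/eqP; rewrite -subr_eq0; apply/eqP.
transitivity ((u * v - p * (1 - u) * (1 - v)) * (f false false - f true true)).
  by ring.
by rewrite uv subrr mul0r.
Qed.

(** Induction on the height of the column: the bottom cell preserves the product law of its two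
    increments, so it emits a right increment of density [v] and passes an independent top increment
    of density [u] to the cells above. *)
Lemma burke n (f : bool -> (nat -> bool) -> R) :
  expect (bernoulli u) (fun b =>
    expect (iid false (bernoulli v) n) (fun J =>
      expect (iid false (bernoulli p) n) (fun x =>
        f (hbit b J x n) (vbit b J x)))) =
  expect (bernoulli u) (fun b => expect (iid false (bernoulli v) n) (f b)).
Proof.
elim: n f => [|n IH] f.
  apply: eq_expect => b; rewrite !expect_iid0 /=; congr (f _ _).
  apply/funext => j; rewrite /vbit orbF andbF; done.
(* The contribution of the cells above the bottom one, which has passed on [b'] and emitted [o]. *)
pose F b' o := expect (iid false (bernoulli v) n) (fun J =>
   expect (iid false (bernoulli p) n) (fun x =>
     f (hbit b' J x n) (scons o (vbit b' J x)))).
transitivity (expect (bernoulli u) (fun b => expect (bernoulli v) (fun a =>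
   expect (bernoulli p) (fun y => F (~~ a && (b || y)) (~~ b && (a || y)))))).
  apply: eq_expect => b; rewrite expect_iidS; apply: eq_expect => a.
  rewrite [RHS]expectC; apply: eq_expect => J; rewrite expect_iidS.
  apply: eq_expect => y; apply: eq_expect => x.
  by rewrite hbit_scons vbit_scons.
rewrite cell expectC.
under eq_expect => a do rewrite (IH (fun h o => f h (scons a o))).
by rewrite expectC; apply: eq_expect => b; rewrite expect_iidS.
Qed.

End burke.

(** * Moment generating function of the height *)

Section exact_mgf.
Variables (p t : R) (n : nat).

Definition bernoulli_field m := iid (fun=> false) (iid false (bernoulli p) n) m.

(** The exponential moment of the height gained along the top edge, for given left increments
    [J]. *)
Let M u m J := expect (iid false (bernoulli u) m) (fun b =>
  expect (bernoulli_field m) (fun xi =>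
    expR (t * ((lpp (count_bits b) (count_bits J) xi m n)%:R
               - (count_bits J n)%:R)))).

Let MS u m J :
  M u m.+1 J = expect (bernoulli u) (fun b =>
    expect (iid false (bernoulli p) n) (fun x =>
      expR (t * (hbit b J x n)%:R) * M u m (vbit b J x))).
Proof.
rewrite /M expect_iidS; apply: eq_expect => b0.
under eq_expect do rewrite /bernoulli_field expect_iidS.
rewrite expectC; apply: eq_expect => x0; rewrite -expectZ.
apply: eq_expect => b; rewrite -expectZ; apply: eq_expect => xi.
rewrite -expRD -mulrDr; congr (expR (t * _)).
rewrite lpp_front.
have -> : (fun k => count_bits (scons b0 b) k.+1) = (fun k => b0 + count_bits b k)%N.
  by apply/funext => k; rewrite count_bits_scons.
have -> : column (count_bits (scons b0 b) 1) (count_bits J) x0 =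
    (fun j => b0 + count_bits (vbit b0 J x0) j)%N.
  by apply/funext => j; rewrite -column_vbit.
rewrite lpp_shift natrD.
have /(congr1 (fun k => k%:R : R)) := column_vbit b0 J x0 n.
by rewrite column_hbit !natrD => /= e; lra.
Qed.

(** By [burke] each column passes product increments to the next one and emits an independent top
    increment of density [u], so the gain along the top edge is a sum of [m] independent bits. *)
Lemma expect_stationary_mgf u v m :
  u * v = p * (1 - u) * (1 - v) ->
  expect (iid false (bernoulli v) n) (fun J =>
    expect (iid false (bernoulli u) m) (fun b =>
      expect (bernoulli_field m) (fun xi =>
        expR (t * ((lpp (count_bits b) (count_bits J) xi m n)%:R
                   - (count_bits J n)%:R))))) = (1 - u + u * expR t) ^+ m *
  expect (iid false (bernoulli v) n) (fun=> 1).
Proof.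
move=> uv; rewrite -[LHS]/(expect _ (M u m)); elim: m => [|m IH].
  rewrite mul1r; apply: eq_expect => J.
  by rewrite /M !expect_iid0 /= subrr mulr0 expR0.
under eq_expect do rewrite MS.
rewrite expectC (burke uv n (fun h o => expR (t * h%:R) * M u m o)).
under eq_expect do rewrite expectZ IH.
by rewrite expect_bernoulli mulr1 mulr0 expR0; rewrite exprS -mulrA; ring.
Qed.

(* Weighting by [expR (t * V n)], where [V n] is the total left boundary, turns
   the density [v'] into the stationary one [v]. *)
Lemma expect_boundary_mgf u v v' m :
  0 <= v <= 1 ->
  v * (1 - v' + v' * expR t) = v' * expR t ->
  1 - v' + v' * expR t != 0 ->
  u * v = p * (1 - u) * (1 - v) ->
  expect (iid false (bernoulli v') n) (fun J =>
    expect (iid false (bernoulli u) m) (fun b =>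
      expect (bernoulli_field m) (fun xi =>
        expR (t * (lpp (count_bits b) (count_bits J) xi m n)%:R)))) =
  (1 - v' + v' * expR t) ^+ n * (1 - u + u * expR t) ^+ m.
Proof.
move=> v01 tilt c0 uv.
have := expect_stationary_mgf m uv.
rewrite (expect_cst 1 (iid_dist false n (bernoulli_dist v01))) mulr1 => <-.
rewrite -expect_tilt //.
apply: eq_expect => J; rewrite -expectZ; apply: eq_expect => b.
rewrite -expectZ; apply: eq_expect => xi.
by rewrite -expRD -mulrDr addrC subrK.
Qed.

End exact_mgf.
End expectation.

(** * Exponential tail bounds *)

Section tails.
Variables (R : realType) (p : R).
Hypotheses (p0 : 0 < p) (p1 : p < 1).

Local Notation bits u n := (iid false (bernoulli u) n).

(* When the left boundary has density [1 - w], [source w t] is the bottom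
   density for which the [t]-tilted boundaries are stationary, and [psi w t m n]
   bounds the logarithm of the moment generating function of [lpp - n]. *)
Definition source (w t : R) : R := p * w / (expR t * (1 - w) + p * w).

Definition psi (w t : R) (m n : nat) : R :=
  m%:R * (source w t * (expR t - 1)) - n%:R * (w * (1 - expR (- t))).

Lemma source_den_gt0 (w t : R) : 0 <= w < 1 -> 0 < expR t * (1 - w) + p * w.
Proof.
move=> /andP[w0 w1]; apply: ltr_wpDr; first by rewrite mulr_ge0 // ltW.
by rewrite mulr_gt0 ?expR_gt0 // subr_gt0.
Qed.

Lemma source_itv (w t : R) : 0 <= w < 1 -> 0 <= source w t <= 1.
Proof.
move=> w01; have d0 := source_den_gt0 t w01; case/andP: w01 => w0 w1.
rewrite /source ler_pdivrMr // mul1r lerDr divr_ge0 ?(ltW d0) //=.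
  by rewrite mulr_ge0 ?expR_ge0 // subr_ge0 ltW.
by rewrite mulr_ge0 // ltW.
Qed.

Lemma bernoulli_field_dist m n : is_dist (bernoulli_field p n m).
Proof. by do 2 apply: iid_dist; apply: bernoulli_dist; rewrite !ltW. Qed.

Lemma pow_le_expR (y : R) n : 0 <= 1 + y -> (1 + y) ^+ n <= expR (n%:R * y).
Proof.
move=> y0; rewrite expRM_natl; apply: lerXn2r; rewrite ?nnegrE ?expR_ge0 //.
exact: expR_ge1Dx.
Qed.

(** Takes [expR t] out of each left factor of the exact formula, then bounds every remaining factor
    by [1 + y <= expR y]. *)
Lemma boundary_mgf_le (w t : R) m n :
  0 <= w < 1 ->
  expect (bits (1 - w) n) (fun J => expect (bits (source w t) m) (fun b =>
    expect (bernoulli_field p n m) (fun xi =>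
      expR (t * (lpp (count_bits b) (count_bits J) xi m n)%:R)))) <=
  expR (t * n%:R + psi w t m n).
Proof.
move=> w01; have d0 := source_den_gt0 t w01; have /andP[w0 w1] := w01.
have e0 : 0 < expR t := expR_gt0 t.
have h0 : 0 < expR t * (1 - w) by rewrite mulr_gt0 // subr_gt0.
have c0 : 0 < 1 - (1 - w) + (1 - w) * expR t.
  by rewrite subKr mulrC ltr_wpDl.
have /andP[u0 u1] := source_itv t w01.
(* The left density after the tilt, with which [source w t] is stationary. *)
pose v := (1 - w) * expR t / (1 - (1 - w) + (1 - w) * expR t).
have tilt : v * (1 - (1 - w) + (1 - w) * expR t) = (1 - w) * expR t.
  by rewrite /v divfK // gt_eqF.
have v01 : 0 <= v <= 1.
  rewrite /v ler_pdivrMr // mul1r divr_ge0 ?(ltW c0) //=.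
    by rewrite lerDr subKr.
  by rewrite mulrC ltW.
rewrite (@expect_boundary_mgf _ p t n (source w t) v) ?gt_eqF //; last first.
  have D1 := lt0r_neq0 d0; have D2 := lt0r_neq0 c0.
  by rewrite /source /v; field; rewrite D1 D2.
have cE : 1 - (1 - w) + (1 - w) * expR t = expR t * (1 + - (w * (1 - expR (- t)))).
  by rewrite expRN; field; rewrite gt_eqF.
have y0 : 0 <= 1 + - (w * (1 - expR (- t))).
  by move: c0; rewrite cE (pmulr_rgt0 _ e0); exact: ltW.
have ue0 : 0 <= source w t * expR t by rewrite mulr_ge0 // ltW.
have ue1 : 0 <= 1 + source w t * (expR t - 1) by lra.
rewrite {}cE exprMn -expRM_natr /psi.
have -> : 1 - source w t + source w t * expR t = 1 + source w t * (expR t - 1) by ring.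
rewrite expRD -[leLHS]mulrA ler_wpM2l ?expR_ge0 // (addrC (m%:R * _)) expRD.
apply: ler_pM; rewrite ?exprn_ge0 //; last by apply: pow_le_expR.
by rewrite -(mulrN n%:R); apply: pow_le_expR.
Qed.

Lemma indic_le_exp (b : bool) (y : R) : (b -> 0 <= y) -> b%:R <= expR y.
Proof.
case: b => [/(_ isT) y0|_]; last exact: expR_ge0.
by apply: le_trans (expR_ge1Dx y); rewrite lerDl.
Qed.

(** Exponential Markov inequality in the model with boundaries, whose height dominates. *)
Lemma upper_tail (w t A : R) m n : 0 <= w < 1 -> 0 <= t ->
  expect (bernoulli_field p n m) (fun xi => (A <= (lpp (fun=> 0%N) (fun=> 0%N) xi m n)%:R)%R%:R)
  <= expR (t * (n%:R - A) + psi w t m n).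
Proof.
move=> w01 t0.
have -> : t * (n%:R - A) + psi w t m n = - (t * A) + (t * n%:R + psi w t m n) by ring.
rewrite expRD.
have dv : is_dist (bits (1 - w) n).
  by apply/iid_dist/bernoulli_dist; case/andP: w01 => w0 w1; lra.
have du : is_dist (bits (source w t) m).
  by apply/iid_dist/bernoulli_dist/source_itv.
apply: le_trans (ler_wpM2l (expR_ge0 _) (boundary_mgf_le t m n w01)).
rewrite -expectZ -[leLHS](expect_cst _ dv); apply: le_expect => // J.
rewrite -expectZ -[leLHS](expect_cst _ du); apply: le_expect => // b.
rewrite -expectZ; apply: le_expect => [|xi]; first exact: bernoulli_field_dist.
rewrite -expRD -mulrN -mulrDr; apply: indic_le_exp => Al.
apply: mulr_ge0 => //; rewrite addrC subr_ge0; apply: le_trans Al _.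
by rewrite ler_nat; apply: leq_lpp.
Qed.

(** If the height without boundary is below [A - B], then the full height is at most [A], or the
    height from the left boundary alone reaches [A], or so do paths leaving the bottom beyond [z],
    or the first [z] bottom bits number at least [B]; otherwise [lpp_exit] and [lpp_boundary_max]
    are contradicted. Each case makes one exponential at least 1. *)
Lemma pointwise_lower (t A B : R) b J xi z k n : 0 <= t ->
  ((lpp (fun=> 0%N) (fun=> 0%N) xi (z + k) n)%:R < A - B)%R%:R <=
  expR (- t * ((lpp (count_bits b) (count_bits J) xi (z + k) n)%:R - A)) +
  (expR (t * ((lpp (fun=> 0%N) (count_bits J) xi (z + k) n)%:R - A)) +
  (expR (t * ((count_bits b z)%:R +
     (lpp (count_bits (fun i => b (z + i)%N)) (fun=> 0%N)
        (fun i => xi (z + i)%N) k n)%:R - A)) +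
  expR ((count_bits b z)%:R - B))) :> R.
Proof.
move=> t0.
have := lpp_boundary_max (count_bits b) (count_bits J) xi (z + k) n.
have := lpp_exit b xi z k n.
move: (lpp (fun=> 0%N) (fun=> 0%N) _ _ _) => l.
move: (lpp (count_bits b) (count_bits J) _ _ _) => bJ.
move: (lpp (fun=> 0%N) (count_bits J) _ _ _) => oJ.
move: (lpp (count_bits b) (fun=> 0%N) _ _ _) => bo.
move: (lpp _ _ _ k n) (count_bits b z) => sh c exit mx.
have one (y e1 e2 : R) : 0 <= y -> 0 <= e1 -> 0 <= e2 -> 1 <= e1 + (expR y + e2).
  by move=> y0 ? ?; have := expR_ge1Dx y; lra.
case: ltP => [lA|_]; last by rewrite !addr_ge0 ?expR_ge0.
have [bJA|AbJ] := leP (bJ%:R : R) A.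
  rewrite -[leRHS]add0r; apply: one => //; rewrite ?addr_ge0 ?expR_ge0 //.
  by rewrite mulNr -mulrN mulr_ge0 // opprB subr_ge0.
have [oJA|AoJ] := leP A (oJ%:R : R).
  apply: one; rewrite ?addr_ge0 ?expR_ge0 //.
  by rewrite mulr_ge0 // subr_ge0.
have [shA|Ash] := leP A (c%:R + sh%:R : R).
  rewrite addrA; apply: one; rewrite ?addr_ge0 ?expR_ge0 //.
  by rewrite mulr_ge0 // subr_ge0.
have [cB|Bc] := leP B (c%:R : R).
  rewrite !addrA -[X in _ <= _ + X]addr0; apply: one => //; first by rewrite subr_ge0.
exfalso.
have : (bJ <= oJ)%N || (bJ <= c + l)%N || (bJ <= c + sh)%N by lia.
rewrite -!(ler_nat R) !natrD => /orP[/orP[]|] h; lra.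
Qed.

(** Averages [pointwise_lower] over the boundaries of the model [w0], stationary under the tilt
    [- t]. Left exits are compared with the left density [1 - w1], late bottom exits with the bottom
    density [source w2 t]: both are at least the actual densities, and heights increase with the
    boundary bits. *)
Lemma lower_tail (w0 w1 w2 t A B : R) z k n :
  0 <= w1 -> w1 <= w0 -> w0 < 1 -> 0 <= w2 < 1 -> 0 <= t ->
  source w0 (- t) <= source w2 t ->
  expect (bernoulli_field p n (z + k)) (fun xi =>
    ((lpp (fun=> 0%N) (fun=> 0%N) xi (z + k) n)%:R < A - B)%R%:R) <=
  expR (- t * (n%:R - A) + psi w0 (- t) (z + k) n) +
  (expR (t * (n%:R - A) + psi w1 t (z + k) n) +
  (expR (z%:R * source w0 (- t) * (expR t - 1) + t * (n%:R - A) + psi w2 t k n) +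
  expR (z%:R * source w0 (- t) * (expR 1 - 1) - B))).
Proof.
move=> w1ge w10 w0lt w2itv t0 uu; set m := (z + k)%N; set u0 := source w0 (- t) in uu *.
have w0itv : 0 <= w0 < 1 by rewrite w0lt andbT (le_trans w1ge).
have w1itv : 0 <= w1 < 1 by rewrite w1ge (le_lt_trans w10).
have u0itv : 0 <= u0 <= 1 := source_itv (- t) w0itv.
have dv (w : R) l : 0 <= w < 1 -> is_dist (bits (1 - w) l).
  by move=> /andP[? ?]; apply/iid_dist/bernoulli_dist; lra.
have du (u : R) l : 0 <= u <= 1 -> is_dist (bits u l).
  by move=> ?; apply/iid_dist/bernoulli_dist.
have df l : is_dist (bernoulli_field p n l) := bernoulli_field_dist l n.
pose Ex f := expect (bits (1 - w0) n) (fun J => expect (bits u0 m) (fun b =>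
  expect (bernoulli_field p n m) (fun xi => f J b xi))).
apply: (@le_trans _ _ (Ex (fun J b xi =>
  expR (- t * ((lpp (count_bits b) (count_bits J) xi m n)%:R - A)) +
  (expR (t * ((lpp (fun=> 0%N) (count_bits J) xi m n)%:R - A)) +
  (expR (t * ((count_bits b z)%:R +
     (lpp (count_bits (fun i => b (z + i)%N)) (fun=> 0%N)
        (fun i => xi (z + i)%N) k n)%:R - A)) +
  expR ((count_bits b z)%:R - B)))))).
  rewrite -[leLHS](expect_cst _ (dv w0 n w0itv)); apply: le_expect; first exact: dv.
  move=> J; rewrite -[leLHS](expect_cst _ (du u0 m u0itv)); apply: le_expect.
    exact: du.
  by move=> b; apply: le_expect => // xi; apply: pointwise_lower.
have ExD f g : Ex (fun J b xi => f J b xi + g J b xi) = Ex f + Ex g.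
  rewrite /Ex -expectD; apply: eq_expect => J.
  by rewrite -expectD; apply: eq_expect => b; rewrite -expectD.
rewrite !ExD; apply: lerD; [|apply: lerD; [|apply: lerD]].
- rewrite (_ : - t * (n%:R - A) + _ = t * A + (- t * n%:R + psi w0 (- t) m n)); last by ring.
  rewrite expRD; apply: le_trans (ler_wpM2l (expR_ge0 _) (boundary_mgf_le (- t) m n w0itv)).
  rewrite /Ex -expectZ; apply: le_expect; [exact: dv|move=> J].
  rewrite -expectZ; apply: le_expect; [exact: du|move=> b].
  rewrite -expectZ; apply: le_expect => // xi.
  by rewrite -expRD ler_expR; lra.
- rewrite (_ : t * (n%:R - A) + _ = - (t * A) + (t * n%:R + psi w1 t m n)); last by ring.
  rewrite expRD; apply: le_trans (ler_wpM2l (expR_ge0 _) (boundary_mgf_le t m n w1itv)).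
  rewrite -expectZ /Ex.
  apply: (@le_trans _ _ (expect (bits (1 - w0) n) (fun J =>
    expect (bernoulli_field p n m) (fun xi =>
      expR (t * ((lpp (fun=> 0%N) (count_bits J) xi m n)%:R - A)))))).
    by apply: le_expect; [exact: dv|move=> J]; rewrite expect_cst //; exact: du.
  apply: (@le_trans _ _ (expect (bits (1 - w1) n) (fun J =>
    expect (bernoulli_field p n m) (fun xi =>
      expR (t * ((lpp (fun=> 0%N) (count_bits J) xi m n)%:R - A)))))).
    apply: le_expect_bernoulli; [lra|lra|lra|move=> J J' JJ'].
    apply: le_expect => // xi; rewrite ler_expR ler_wpM2l // lerD2r ler_nat.
    apply: leq_lpp => // j; apply: leq_count_bits => i.
    by have := JJ' i; case: (J i) (J' i) => [] [] //; apply.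
  apply: le_expect; [exact: dv|move=> J].
  rewrite -expectZ -[leLHS](expect_cst _ (du _ m (source_itv t w1itv))).
  apply: le_expect; [exact/du/source_itv|move=> b].
  rewrite -expectZ; apply: le_expect => // xi.
  rewrite -expRD ler_expR -mulrN -mulrDr ler_wpM2l // addrC lerD2l ler_nat.
  exact: leq_lpp.
- rewrite (_ : _ + t * _ + _ = z%:R * u0 * (expR t - 1) +
     (- (t * A) + (t * n%:R + psi w2 t k n))); last by ring.
  (* The first [z] bottom bits are independent of the later bits and of the columns beyond [z], so
     the expectation factorizes. *)
  have -> : Ex (fun J b xi => expR (t * ((count_bits b z)%:R +
     (lpp (count_bits (fun i => b (z + i)%N)) (fun=> 0%N)
        (fun i => xi (z + i)%N) k n)%:R - A))) =
    expect (bits u0 z) (fun g => expR (t * (count_bits g z)%:R)) *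
    (expR (- (t * A)) * expect (bits u0 k) (fun h => expect (bernoulli_field p n k) (fun xi =>
      expR (t * (lpp (count_bits h) (fun=> 0%N) xi k n)%:R)))).
    rewrite /Ex (expect_cst _ (dv _ _ w0itv)).
    rewrite (expect_count_split _ _ _ (fun c b => expect (bernoulli_field p n m) (fun xi =>
      expR (t * (c%:R + (lpp (count_bits b) (fun=> 0%N)
        (fun i => xi (z + i)%N) k n)%:R - A))))).
    rewrite [RHS]mulrC -[RHS]expectZ; apply: eq_expect => g.
    rewrite [RHS]mulrC mulrA -[RHS]expectZ; apply: eq_expect => h; rewrite -[RHS]expectZ.
    rewrite (expect_iid_drop _ _ _ (fun xi => expR (t * ((count_bits g z)%:R +
      (lpp (count_bits h) (fun=> 0%N) xi k n)%:R - A)))); last first.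
      by apply/iid_dist/bernoulli_dist; rewrite !ltW.
    by apply: eq_expect => xi; rewrite -!expRD; congr (expR _); ring.
  rewrite expRD expRD; apply: ler_pM.
  + by apply: expect_ge0 => [|g]; [exact: du|exact: expR_ge0].
  + rewrite mulr_ge0 ?expR_ge0 //; apply: expect_ge0 => [|h]; first exact: du.
    by apply: expect_ge0 => [|xi]; [exact: df|exact: expR_ge0].
  + rewrite expect_exp_count -mulrA.
    have -> : 1 - u0 + u0 * expR t = 1 + u0 * (expR t - 1) by ring.
    apply: pow_le_expR; case/andP: u0itv => h1 h2.
    have : 0 <= u0 * expR t by rewrite mulr_ge0 ?expR_ge0.
    lra.
  rewrite ler_wpM2l ?expR_ge0 //.
  apply: le_trans (boundary_mgf_le t k n w2itv).
  rewrite -[leLHS](expect_cst _ (dv w2 n w2itv)).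
  apply: le_expect; [exact: dv|move=> J].
  apply: (@le_trans _ _ (expect (bits (source w2 t) k) (fun h =>
      expect (bernoulli_field p n k) (fun xi =>
        expR (t * (lpp (count_bits h) (fun=> 0%N) xi k n)%:R))))).
    apply: le_expect_bernoulli => //; [by case/andP: u0itv|by case/andP: (source_itv t w2itv)|].
    move=> b b' bb'; apply: le_expect => // xi; rewrite ler_expR ler_wpM2l // ler_nat.
    apply: leq_lpp => // j; apply: leq_count_bits => i.
    by have := bb' i; case: (b i) (b' i) => [] [] //; apply.
  apply: le_expect; [exact/du/source_itv|move=> b].
  apply: le_expect => // xi; rewrite ler_expR ler_wpM2l // ler_nat.
  exact: leq_lpp.
- rewrite /Ex (expect_cst _ (dv _ _ w0itv)).
  have -> : expect (bits u0 m) (fun b => expect (bernoulli_field p n m) (fun=>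
     expR ((count_bits b z)%:R - B))) =
    expR (- B) * expect (bits u0 z) (fun g => expR (1 * (count_bits g z)%:R)).
    rewrite (expect_count_split _ _ _ (fun c _ => expect (bernoulli_field p n m) (fun=>
      expR (c%:R - B)))).
    rewrite -expectZ; apply: eq_expect => g.
    by rewrite (expect_cst _ (du _ _ u0itv)) (expect_cst _ (df _)) mul1r addrC expRD.
  rewrite addrC expRD ler_wpM2l ?expR_ge0 // expect_exp_count -mulrA.
  have -> : 1 - u0 + u0 * expR 1 = 1 + u0 * (expR 1 - 1) by ring.
  apply: pow_le_expR; case/andP: u0itv => h1 h2.
  have : 0 <= u0 * expR 1 by rewrite mulr_ge0 ?expR_ge0.
  lra.
Qed.
End tails.

(** * Law of the marked sites *)

(** Gives a random sequence the shape of the samples of [iid]. *)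
Definition trunc A (a0 : A) (n : nat) (g : nat -> A) (k : nat) : A :=
  if (k < n)%N then g k else a0.

Lemma truncS A (a0 : A) n g :
  trunc a0 n.+1 g = scons (g 0%N) (trunc a0 n (fun k => g k.+1)).
Proof. by apply/funext => -[|k]. Qed.

Section simulation.
Variables (R : realType) (d : measure_display) (T : measurableType d)
  (P : probability T R) (p : R) (X : int * int -> {RV P >-> R}).
Hypothesis X1 : forall v, P [set w | X v w = 1] = p%:E.
Hypothesis Xind : mutually_independent X.

Local Notation site := (int * int)%type.

Let cyl (J : {fset site}) (B : site -> set R) :=
  \bigcap_(i in [set` J]) (X i @^-1` B i).

(* [EE] computes the law of [Y], which is independent of the sites outside [V]. *)
Definition simulates A (EE : (A -> R) -> R) (Y : T -> A) (V : site -> Prop) :=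
  forall Q : A -> bool,
    measurable [set w | Q (Y w)] /\
    forall (J : {fset site}) (B : site -> set R),
      (forall i, i \in J -> measurable (B i)) -> (forall i, i \in J -> ~ V i) ->
      P (cyl J B `&` [set w | Q (Y w)]) =
      (P (cyl J B) * (EE (fun y => (Q y)%:R))%:E)%E.

Lemma simulates_cst A (a : A) V : simulates (fun f => f a) (fun=> a) V.
Proof.
move=> Q; case: (Q a); last first.
  rewrite (_ : [set w : T | false] = set0); last by apply/seteqP; split.
  by split=> // J B _ _; rewrite setI0 measure0 mule0.
rewrite (_ : [set w : T | true] = setT); last by apply/seteqP; split.
by split=> // J B _ _; rewrite setIT mule1.
Qed.

Lemma simulates_map A A' (h : A -> A') EE EE' (Y : T -> A) V :
  (forall f, EE' f = EE (f \o h)) ->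
  simulates EE Y V -> simulates EE' (h \o Y) V.
Proof.
by move=> e sim Q; have [mQ eQ] := sim (Q \o h); split=> // J B mB JV; rewrite e eQ.
Qed.

Lemma simulates_sub A EE (Y : T -> A) (V V' : site -> Prop) :
  (forall i, V i -> V' i) -> simulates EE Y V -> simulates EE Y V'.
Proof.
move=> VV sim Q; have [mQ eQ] := sim Q; split=> // J B mB JV.
by apply: eQ => // i iJ /VV; apply: JV.
Qed.

Let cyl_cons J (B : site -> set R) v (C : set R) :
  measurable C -> (forall i, i \in J -> measurable (B i)) -> v \notin J ->
  let B' i := if i == v then C else B i in
  cyl (v |` J)%fset B' = cyl J B `&` (X v @^-1` C) /\
  P (cyl (v |` J)%fset B') = (P (cyl J B) * P (X v @^-1` C))%E.
Proof.
move=> mC mB vJ B'; have BB' i : i \in J -> B' i = B i.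
  by rewrite /B'; case: eqP => // ->; rewrite (negPf vJ).
split.
  apply/seteqP; split => w /=.
    move=> h; split=> [i iJ|].
      by rewrite -(BB' i iJ); apply: h; rewrite /= !inE; apply/orP; right.
    by have := h v; rewrite /= /B' eqxx; apply; rewrite !inE eqxx.
  move=> [h1 h2] i; rewrite /= !inE => /orP[/eqP ->|iJ].
    by rewrite /B' eqxx.
  by rewrite (BB' i iJ); apply: h1.
rewrite /cyl !Xind; last 2 first.
- exact: mB.
- by move=> i; rewrite !inE => /orP[/eqP ->|iJ]; [rewrite /B' eqxx|rewrite BB' //; exact: mB].
rewrite big_fsetU1 //= muleC /B' eqxx; congr (_ * _)%E.
by rewrite big_seq [RHS]big_seq; apply: eq_bigr => i iJ; have := BB' i iJ; rewrite /B' => ->.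
Qed.

(** The event splits according to whether [X v] equals 1. In each case the condition on [X v] joins
    the cylinder, whose sites still avoid [V], and independence factors out its probability. *)
Lemma simulates_bit A EE (Y : T -> A) (V : site -> Prop) v :
  (forall Q : A -> bool, 0 <= EE (fun y => (Q y)%:R)) ->
  ~ V v -> simulates EE Y V ->
  simulates (fun f => expect (bernoulli p) (fun b => EE (fun y => f (b, y))))
    (fun w => (X v w == 1, Y w)) (fun i => i = v \/ V i).
Proof.
move=> EE0 Vv sim Q.
have m1 : measurable ([set 1] : set R) by exact: measurable_set1.
have mX C : measurable C -> measurable (X v @^-1` C).
  by move=> mC; rewrite -[X in measurable X]setTI; apply: measurable_funP.
have [mQ1 eQ1] := sim (fun y => Q (true, y)).
have [mQ0 eQ0] := sim (fun y => Q (false, y)).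
have split_event : [set w | Q (X v w == 1, Y w)] =
    ((X v @^-1` [set 1]) `&` [set w | Q (true, Y w)]) `|`
    ((X v @^-1` (~` [set 1])) `&` [set w | Q (false, Y w)]).
  apply/seteqP; split=> w /=.
    by case: (eqVneq (X v w) 1) => [e|/eqP e] h; [left|right].
  by case=> -[]; [move=> -> ; rewrite eqxx|move=> /eqP/negPf ->].
have mQ : measurable [set w | Q (X v w == 1, Y w)].
  rewrite split_event; apply: measurableU; apply: measurableI.
  - exact: mX.
  - exact: mQ1.
  - by apply: mX; apply: measurableC.
  - exact: mQ0.
split=> // J B mB JV.
have vJ : v \notin J by apply/negP => /JV; apply; left.
have mcyl : measurable (cyl J B).
  apply: fin_bigcap_measurable; first exact: finite_fset.
  move=> i iJ; rewrite -[X in measurable X]setTI; apply: measurable_funP => //.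
  exact: mB.
have step C b : measurable C ->
    P (cyl J B `&` (X v @^-1` C) `&` [set w | Q (b, Y w)]) =
    (P (cyl J B) * P (X v @^-1` C) * (EE (fun y => (Q (b, y))%:R))%:E)%E.
  move=> mC; have [<- <-] := cyl_cons mC mB vJ.
  have [_ e] := sim (fun y => Q (b, y)); apply: e => i.
    rewrite !inE => /orP[/eqP ->|iJ]; first by rewrite eqxx.
    by case: ifP => // _; apply: mB.
  by rewrite !inE => /orP[/eqP -> //|iJ] Vi; apply: (JV i iJ); right.
rewrite split_event setIUr !setIA measureU; last 3 first.
- by apply: measurableI => //; apply: measurableI => //; exact: mX.
- by apply: measurableI => //; apply: measurableI => //; apply: mX; apply: measurableC.
- by rewrite -subset0 => w /= [[[_ e] _] [[_ ne] _]].
have e1 := step [set 1] true m1.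
have e0 := step (~` [set 1]) false (measurableC m1).
etransitivity; first exact: (f_equal2 (fun a b : \bar R => a + b)%E e1 e0).
have -> : P (X v @^-1` [set 1]) = p%:E by exact: X1.
have -> : P (X v @^-1` (~` [set 1])) = (1 - p)%:E.
  by rewrite -preimage_setC probability_setC ?(X1 v) ?EFinB //; exact: mX.
rewrite expect_bernoulli -(fineK (fin_num_measure P _ mcyl)) -!EFinM -EFinD.
by congr (_%:E); ring.
Qed.

Lemma simulates_column A EE (Y : T -> A) (V : site -> Prop) (v : nat -> site) n :
  (forall Q : A -> bool, 0 <= EE (fun y => (Q y)%:R)) ->
  0 <= p <= 1 -> injective v -> (forall j, ~ V (v j)) -> simulates EE Y V ->
  simulates
    (fun f => expect (iid false (bernoulli p) n) (fun g => EE (fun y => f (g, y))))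
    (fun w => (trunc false n (fun j => X (v j) w == 1), Y w))
    (fun i => V i \/ exists j, i = v j).
Proof.
move=> EE0 p01 vinj Vv sim; elim: n v vinj Vv => [|n IH] v vinj Vv.
  apply: (@simulates_sub _ _ _ V) => [i|]; first by left.
  apply: (@simulates_map _ _ (fun y => (fun=> false, y)) EE) sim => f.
  by rewrite expect_iid0.
have /IH {}IH : injective (fun j => v j.+1) by move=> j k /vinj[].
have {}IH := IH (fun j => Vv j.+1).
have := simulates_bit _ _ IH => /(_ (v 0%N)) {}IH.
apply: (@simulates_sub _ _ _
    (fun i => i = v 0%N \/ V i \/ exists j, i = v j.+1)) => [i|].
  by case=> [->|[?|[j ->]]]; [right; exists 0%N|left|right; exists j.+1].
have -> : (fun w => (trunc false n.+1 (fun j => X (v j) w == 1), Y w)) =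
    (fun y => (scons y.1 y.2.1, y.2.2)) \o (fun w =>
      (X (v 0%N) w == 1, (trunc false n (fun j => X (v j.+1) w == 1), Y w))).
  by apply/funext => w; rewrite truncS.
apply: (@simulates_map _ _ (fun y => (scons y.1 y.2.1, y.2.2)) _ _ _ _ _ (IH _ _)).
- by move=> f; rewrite expect_iidS.
- move=> Q; apply: expect_ge0 => [|g]; last exact: (EE0 (fun y => Q (g, y))).
  exact/iid_dist/bernoulli_dist.
- by case=> [/Vv //|[j /vinj]].
Qed.

Lemma simulates_field m n (v : nat -> nat -> site) :
  0 <= p <= 1 -> (forall i j k l, v i j = v k l -> i = k /\ j = l) ->
  simulates (expect (bernoulli_field p n m))
    (fun w => trunc (fun=> false) m
      (fun i => trunc false n (fun j => X (v i j) w == 1)))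
    (fun s => exists i j, s = v i j).
Proof.
move=> p01; elim: m v => [|m IH] v vinj.
  apply: (@simulates_map _ _ id (fun f => f (fun=> fun=> false)) _ (fun=> fun=> fun=> false)).
    by move=> f; rewrite /bernoulli_field expect_iid0.
  exact: simulates_cst.
have vinj' i j k l : v i.+1 j = v k.+1 l -> i = k /\ j = l by move=> /vinj[[->] ->].
have {}IH := IH (fun i => v i.+1) vinj'.
have -> : (fun w => trunc (fun=> false) m.+1
      (fun i => trunc false n (fun j => X (v i j) w == 1))) =
    (fun y => scons y.1 y.2) \o (fun w =>
      (trunc false n (fun j => X (v 0%N j) w == 1), trunc (fun=> false) m
      (fun i => trunc false n (fun j => X (v i.+1 j) w == 1)))).
  by apply/funext => w; rewrite truncS.
apply: (@simulates_sub _ _ _ (fun s =>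
    (exists i j, s = v i.+1 j) \/ exists j, s = v 0%N j)) => [s|].
  by case=> [[i [j ->]]|[j ->]]; [exists i.+1, j|exists 0%N, j].
apply: (@simulates_map _ _ (fun y => scons y.1 y.2) _ _ _ _ _
  (simulates_column n _ p01 _ _ IH)).
- by move=> f; rewrite /bernoulli_field expect_iidS.
- move=> Q; apply: expect_ge0 => [|g]; last exact: ler0n.
  by do 2 apply: iid_dist; apply: bernoulli_dist.
- by move=> j k /vinj[].
- by move=> j [i [k /vinj[]]].
Qed.

(** The case of an empty cylinder, which has probability one; truncation changes no cell inside the
    rectangle. *)
Lemma probability_lpp (Q : nat -> bool) m n : 0 <= p <= 1 ->
  P [set w | Q (L (fun v => X v w == 1) m%:Z n%:Z)] =
  (expect (bernoulli_field p n m)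
    (fun xi => (Q (lpp (fun=> 0%N) (fun=> 0%N) xi m n))%:R))%:E.
Proof.
move=> p01; pose v (i j : nat) : site := (i.+1%:Z, j.+1%:Z).
have vinj i j k l : v i j = v k l -> i = k /\ j = l by case=> -> ->.
have [_ sim] := simulates_field m n p01 vinj
  (fun xi => Q (lpp (fun=> 0%N) (fun=> 0%N) xi m n)).
have := sim fset0 (fun=> setT) => {}sim.
rewrite -[RHS]mul1e -(probability_setT P) -[setT in RHS](bigcap_set0 (fun i => X i @^-1` setT)).
have e : [set` (fset0 : {fset site})] = set0 by apply/seteqP; split => i.
move: sim; rewrite /cyl e bigcap_set0 setTI => <- //.
congr (P _); apply/seteqP; split => w /=; rewrite L_lpp (@eq_lpp _ _ _ (trunc (fun=> false) m
      (fun i => trunc false n (fun j => X (v i j) w == 1)))) // => i j im jn.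
  by rewrite /trunc im jn.
by rewrite /trunc im jn.
Qed.

End simulation.

(** * Asymptotics *)

Section asymptotics.
(* [s n] stands for [n `^ (a - 1)]: then [n * s n] is [n `^ a] and
   [n * s n ^+ 2] is [n `^ (2 * a - 1)]. *)
Variables (R : realType) (p : R) (s : nat -> R).
Hypotheses (p0 : 0 < p) (p1 : p < 1).
Hypothesis s_gt0 : \forall n \near \oo, 0 < s n.
Hypothesis s_to0 : s n @[n --> \oo] --> 0.
Hypothesis ns_inv_to0 : (n%:R * s n)^-1 @[n --> \oo] --> 0.

Local Notation q := (1 - p).

(* The limit of [psi (om * s n) t m n / (n * s n ^ 2)]. *)
Definition psi_lim (om y t : R) : R :=
  (1 - expR (- t)) * om * ((1 - p * expR (- t)) * om - p * y).

(** The terms of order [n] cancel against [m] close to [p^-1 * n]. The deviation of [m] from its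
    target is a separate term, which becomes negligible after division by [n * s n]. *)
Lemma psi_ratio (om y t : R) m n : (0 < n)%N -> 0 < s n -> 0 <= om * s n < 1 ->
  psi p (om * s n) t m n = n%:R * s n ^+ 2 *
  ((1 - expR (- t)) * om *
   ((1 - p * expR (- t)) * om - p * y +
    p * (m%:R - (p^-1 * n%:R - y * (n%:R * s n))) * (n%:R * s n)^-1) /
   (1 - (1 - p * expR (- t)) * om * s n)).
Proof.
move=> n0 sn w01; have D1 := lt0r_neq0 (source_den_gt0 p0 t w01).
have E0 : expR t != 0 by rewrite gt_eqF ?expR_gt0.
have n0' : n%:R != 0 :> R by rewrite pnatr_eq0 -lt0n.
rewrite /psi /source expRN; move: (expR t) E0 D1 => E E0 D1.
field; rewrite E0 (gt_eqF sn) n0' (gt_eqF p0) /= !andbT.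
by rewrite (_ : _ - _ = E * (1 - om * s n) + p * (om * s n)) //; ring.
Qed.

(** The tolerance 2 leaves room for two roundings, that of the width and that of a number of removed
    columns. *)
Lemma psi_eventually (om y t e : R) (m : nat -> nat) :
  0 <= om -> 0 < e ->
  (\forall n \near \oo, `|(m n)%:R - (p^-1 * n%:R - y * (n%:R * s n))| <= 2) ->
  \forall n \near \oo,
    psi p (om * s n) t (m n) n <= n%:R * s n ^+ 2 * (psi_lim om y t + e).
Proof.
move=> om0 e0 mE.
pose g n := p * ((m n)%:R - (p^-1 * n%:R - y * (n%:R * s n))) * (n%:R * s n)^-1.
have g0 : g n @[n --> \oo] --> 0.
  have b0 : 2 * p * (n%:R * s n)^-1 @[n --> \oo] --> 2 * p * 0.
    by apply: cvgM ns_inv_to0; exact: cvg_cst.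
  rewrite mulr0 in b0.
  apply: (@squeeze_cvgr _ _ _ _ 
    (fun n => - (2 * p * (n%:R * s n)^-1)) (fun n => 2 * p * (n%:R * s n)^-1)) => //; last first.
    by rewrite -oppr0; apply: cvgN.
  near=> n; rewrite /g.
  have sn : 0 < s n by near: n.
  have : `|(m n)%:R - (p^-1 * n%:R - y * (n%:R * s n))| <= 2 by near: n.
  move: (_ - _) => r; rewrite ler_norml => /andP[r1 r2].
  have i0 : 0 <= (n%:R * s n)^-1 by rewrite invr_ge0 mulr_ge0 // ltW.
  rewrite -mulNr; apply/andP; split; rewrite ler_wpM2r //.
    by have := ler_wpM2l (ltW p0) r1; lra.
  by have := ler_wpM2l (ltW p0) r2; lra.
have lim : (1 - expR (- t)) * om * ((1 - p * expR (- t)) * om - p * y + g n) /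
   (1 - (1 - p * expR (- t)) * om * s n) @[n --> \oo] --> 
   (1 - expR (- t)) * om * ((1 - p * expR (- t)) * om - p * y + 0) /
   (1 - (1 - p * expR (- t)) * om * 0).
  apply: cvgM.
    by apply: cvgM; [exact: cvg_cst|apply: cvgD => //; exact: cvg_cst].
  apply: cvgV; first by rewrite mulr0 subr0 oner_eq0.
  by apply: cvgB; [exact: cvg_cst|apply: cvgM => //; exact: cvg_cst].
rewrite addr0 mulr0 subr0 divr1 -/(psi_lim om y t) in lim.
have lt_e : psi_lim om y t < psi_lim om y t + e by rewrite ltrDl.
have near_lim := cvgr_lt _ lim _ lt_e.
have om_s : om * s n @[n --> \oo] --> om * 0.
  by apply: cvgM => //; exact: cvg_cst.
rewrite mulr0 in om_s.
near=> n.
have n0 : (0 < n)%N by near: n; exists 1%N.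
have sn : 0 < s n by near: n.
rewrite (@psi_ratio om y) //; last first.
  rewrite mulr_ge0 ?(ltW sn) //=.
  by near: n; apply: (cvgr_lt 0 om_s); rewrite ltr01.
rewrite ler_wpM2l //; first by rewrite mulr_ge0 // sqr_ge0.
apply: ltW.
by near: n; exact: near_lim.
Unshelve. all: by end_near. Qed.

Lemma expR_quadratic (t : R) : `|t| <= 1 / 2 ->
  `|1 - expR (- t) - t| <= 2 * t ^+ 2.
Proof.
rewrite ler_norml => /andP[t1 t2].
have h1 := expR_ge1Dx (- t).
have h2 : (1 + t) * expR (- t) <= 1.
  by rewrite expRN ler_pdivrMr ?expR_gt0 // mul1r expR_ge1Dx.
rewrite ler_norml; apply/andP; split; nra.
Qed.

(** First-order expansion in [t], for both signs because tilts of both signs are used. *)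
Lemma psi_lim_le (om y e : R) : 0 <= om -> 0 < e ->
  exists2 t0, 0 < t0 & forall t, 0 < `|t| <= t0 ->
    psi_lim om y t <= - t * (p * y * om - q * om ^+ 2) + e * `|t|.
Proof.
move=> om0 e0.
(* The second-order error is at most [K * t ^ 2]; the denominator [K + 1] below cannot vanish. *)
pose K := 2 * `|q * om ^+ 2 - p * y * om| + 4 * om ^+ 2.
have K0 : 0 <= K by rewrite addr_ge0 ?mulr_ge0 ?sqr_ge0.
exists (Num.min (1 / 2) (e / (K + 1))).
  by rewrite lt_min divr_gt0 //= divr_gt0 //; lra.
move=> t /andP[t_gt0]; rewrite le_min => /andP[t1 t2].
have := expR_quadratic t1; rewrite /psi_lim.
set a := 1 - expR (- t) => ha.
have -> : (1 - p * expR (- t)) = q + p * a by rewrite /a; ring.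
pose b := q * om ^+ 2 - p * y * om.
have -> : a * om * ((q + p * a) * om - p * y) =
   - t * (p * y * om - q * om ^+ 2) + ((a - t) * b + p * a ^+ 2 * om ^+ 2).
  by rewrite /b; ring.
rewrite lerD2l.
have t_sq : t ^+ 2 = `|t| ^+ 2 by rewrite real_normK ?num_real.
have h1 : (a - t) * b <= 2 * `|t| ^+ 2 * `|b|.
  apply: le_trans (ler_norm _) _; rewrite normrM ler_wpM2r // -t_sq //.
have a2 : `|a| <= 2 * `|t|.
  rewrite -[a](subrK t); apply: le_trans (ler_normD _ _) _.
  rewrite t_sq in ha; have u2 : 0 <= `|t| * (1 / 2 - `|t|) by rewrite mulr_ge0 // subr_ge0.
  apply: le_trans (lerD ha (lexx _)) _; move: (`|t|) u2 => u u2; lra.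
have h2 : p * a ^+ 2 * om ^+ 2 <= 4 * `|t| ^+ 2 * om ^+ 2.
  rewrite ler_wpM2r ?sqr_ge0 //.
  have a_sq : a ^+ 2 = `|a| ^+ 2 by rewrite real_normK ?num_real.
  rewrite a_sq; apply: (@le_trans _ _ (`|a| ^+ 2)).
    by rewrite ler_piMl ?sqr_ge0 // ltW.
  rewrite (_ : 4 * _ = (2 * `|t|) ^+ 2); last by ring.
  by rewrite lerXn2r ?nnegrE ?mulr_ge0.
apply: le_trans (lerD h1 h2) _.
have -> : 2 * `|t| ^+ 2 * `|b| + 4 * `|t| ^+ 2 * om ^+ 2 = K * `|t| * `|t|.
  by rewrite /K -/b; ring.
rewrite ler_wpM2r //; rewrite ler_pdivlMr ?ltr_wpDl // in t2.
apply: le_trans t2; rewrite mulrDr mulr1 mulrC lerDl //.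
Qed.

(** The threshold [t0] precedes both [m] and [n], so that one fixed tilt serves several sequences of
    widths. *)
Lemma psi_le (om y e : R) : 0 <= om -> 0 < e ->
  exists2 t0, 0 < t0 & forall t, 0 < `|t| <= t0 -> forall m : nat -> nat,
    (\forall n \near \oo, `|(m n)%:R - (p^-1 * n%:R - y * (n%:R * s n))| <= 2) ->
    \forall n \near \oo, psi p (om * s n) t (m n) n <=
      n%:R * s n ^+ 2 * (- t * (p * y * om - q * om ^+ 2) + e * `|t|).
Proof.
move=> om0 e0; have [|t0 t00 H] := @psi_lim_le om y (e / 2) om0; first by lra.
exists t0 => // t tt m mE; have := H t tt; case/andP: tt => tgt0 _ psil.
have e' : 0 < e / 2 * `|t| by rewrite mulr_gt0 //; lra.
have := @psi_eventually om y t _ m om0 e' mE.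
apply: filterS => n h; apply: le_trans h _.
rewrite ler_wpM2l //; first by rewrite mulr_ge0 // sqr_ge0.
lra.
Qed.

(** The odds of [source p w t] are [p * w * expR (- t) / (1 - w)], and the assumptions order their
    numerators and denominators. *)
Lemma source_le (w0 w2 t : R) : 0 <= w0 -> w0 <= w2 -> w2 < 1 ->
  w0 * expR t <= w2 * expR (- t) -> source p w0 (- t) <= source p w2 t.
Proof.
move=> w00 w02 w21 h.
have w0itv : 0 <= w0 < 1 by rewrite w00 (le_lt_trans w02).
have w2itv : 0 <= w2 < 1 by rewrite (le_trans w00 w02).
have d0 := source_den_gt0 p0 (- t) w0itv.
have d2 := source_den_gt0 p0 t w2itv.
rewrite /source ler_pdivrMr // mulrAC ler_pdivlMr //.
have h1 : w0 * expR t * (1 - w2) <= w2 * expR (- t) * (1 - w0).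
  by apply: ler_pM => //; rewrite ?mulr_ge0 ?expR_ge0 //; lra.
rewrite -[leLHS]mulrA -[leRHS]mulrA ler_wpM2l ?(ltW p0) //.
move: (expR t) (expR (- t)) h1 => E E'; lra.
Qed.

Lemma source_ub (w t : R) : 0 <= w -> 0 <= t -> expR (- t) <= 1 - w ->
  source p w (- t) <= p * w * expR t ^+ 2.
Proof.
move=> w0 t0 h; have e0 := expR_gt0 (- t).
have w1 : 0 < 1 - w by apply: lt_le_trans h.
have pw0 : 0 <= p * w by rewrite mulr_ge0 // ltW.
rewrite /source ler_wpM2l //.
rewrite (_ : expR t ^+ 2 = (expR (- t) ^+ 2)^-1); last by rewrite -exprVn expRN invrK.
rewrite lef_pV2 ?posrE ?exprn_gt0 //; last first.
  by apply: ltr_wpDr => //; rewrite mulr_gt0.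
rewrite expr2 -[leLHS]addr0 lerD // ler_wpM2l // ltW //.
Qed.

(** With [y = expR (- t) >= 1 - t] the left side is [(1 - y) / y ^ 3], at most [t / (1 - t) ^ 3].
    The constant 14 gives equality of this bound with the right side at [t = 1 / 2]. *)
Lemma expR_cubic (t : R) : 0 <= t <= 1 / 2 ->
  expR t ^+ 2 * (expR t - 1) <= t + 14 * t ^+ 2.
Proof.
move=> /andP[t0 t1]; have y1 := expR_ge1Dx (- t).
rewrite -[expR t]invrK -expRN; move: (expR (- t)) (expR_gt0 (- t)) y1 => y y0 y1.
rewrite (_ : _ * _ = (1 - y) / y ^+ 3); last by field; rewrite gt_eqF.
rewrite ler_pdivrMr ?exprn_gt0 //; apply: (@le_trans _ _ t); first by lra.
apply: (@le_trans _ _ ((t + 14 * t ^+ 2) * (1 - t) ^+ 3)); last first.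
  rewrite ler_wpM2l ?addr_ge0 ?mulr_ge0 ?sqr_ge0 // lerXn2r ?nnegrE //; lra.
have -> : (t + 14 * t ^+ 2) * (1 - t) ^+ 3 =
   t + t ^+ 2 * ((1 - 2 * t) * (11 - 17 * t + 7 * t ^+ 2)) by ring.
rewrite lerDl !mulr_ge0 ?sqr_ge0 //; first by lra.
have := sqr_ge0 t; lra.
Qed.

(** Provides the assumption of [source_le]: since [expR (- t) >= 1 - t], a gap [v - u] of at least
    [2 * t * v] is enough. *)
Lemma mul_expR_le (u v t : R) : 0 <= v -> 0 <= t -> t <= 1 / 2 ->
  t * (2 * v) <= v - u -> u * expR t <= v * expR (- t).
Proof.
move=> v0 t0 t1 h; have y1 := expR_ge1Dx (- t); have y0 := expR_gt0 (- t).
rewrite -[expR t]invrK -expRN ler_pdivrMr // -mulrA -expr2.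
apply: (@le_trans _ _ (v * (1 - t) ^+ 2)); last first.
  by rewrite ler_wpM2l // lerXn2r ?nnegrE //; lra.
by have : 0 <= v * t ^+ 2 by [rewrite mulr_ge0 ?sqr_ge0]; lra.
Qed.

Lemma expR_half (t : R) : 0 <= t <= 1 / 2 -> expR t <= 2.
Proof.
move=> /andP[t0 t1]; have y1 := expR_ge1Dx (- t).
rewrite -[expR t]invrK -expRN invf_ple ?posrE ?expR_gt0 //; lra.
Qed.

(** * Exponential rates of both deviations *)

Variables (x : R) (m : nat -> nat).
Hypothesis x0 : 0 <= x.
Hypothesis mE : \forall n \near \oo,
  `|(m n)%:R - (p^-1 * n%:R - x * (n%:R * s n))| <= 1.

Local Notation c := ((p * x) ^+ 2 / (4 * q)).
Local Notation N n := (n%:R * s n ^+ 2).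
Local Notation lpp0 := (lpp (fun=> 0%N) (fun=> 0%N)).

Let q0 : 0 < q. Proof. by rewrite subr_gt0. Qed.

Let near_lt1 om : \forall n \near \oo, om * s n < 1.
Proof.
have h : om * s n @[n --> \oo] --> om * 0 by apply: cvgM => //; exact: cvg_cst.
rewrite mulr0 in h; have := cvgr_lt _ h _ ltr01; exact.
Qed.

Let mE2 : \forall n \near \oo,
  `|(m n)%:R - (p^-1 * n%:R - x * (n%:R * s n))| <= 2.
Proof. by apply: filterS mE => n h; apply: le_trans h _; rewrite ler1n. Qed.

Lemma upper_tail_limit e : 0 < e ->
  exists2 dl, 0 < dl & \forall n \near \oo,
    expect (bernoulli_field p n (m n)) (fun xi =>
      (n%:R - (c - e) * N n <= (lpp0 xi (m n) n)%:R)%R%:R) <= expR (- dl * N n).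
Proof.
(* The maximizer of [p * x * om - q * om ^ 2], with maximum [c]. Half of the slack [e] pays for the
   error in [psi_le]. *)
move=> e0; pose om := p * x / (2 * q).
have om0 : 0 <= om by rewrite /om divr_ge0 ?mulr_ge0 // ltW.
have [|t t0 H] := @psi_le om x (e / 2) om0.
  by lra.
have {}H := H t _ m mE2; have nt : `|t| = t by rewrite gtr0_norm.
exists (t * e / 2); first by rewrite divr_gt0 ?mulr_gt0.
have {}H := H _; rewrite nt lexx t0 in H; have {}H := H isT.
near=> n.
have sn : 0 < s n by near: n.
have N0 : 0 <= N n by rewrite mulr_ge0 // sqr_ge0.
have w01 : 0 <= om * s n < 1.
  by rewrite mulr_ge0 ?(ltW sn) //=; near: n; exact: near_lt1.
apply: le_trans (upper_tail p0 p1 _ _ _ w01 (ltW t0)) _.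
rewrite ler_expR.
have : psi p (om * s n) t (m n) n <=
  N n * (- t * (p * x * om - (1 - p) * om ^+ 2) + e / 2 * t) by near: n; exact: H.
have -> : p * x * om - (1 - p) * om ^+ 2 = c.
  by rewrite /om; field; rewrite gt_eqF.
move=> h; have -> : t * (n%:R - (n%:R - (c - e) * N n)) = N n * (t * (c - e)) by ring.
apply: le_trans (lerD (lexx _) h) _; rewrite -mulrDr.
rewrite (_ : - _ * N n = N n * (- (t * e / 2))); last by ring.
by rewrite ler_wpM2l //; lra.
Unshelve. all: by end_near. Qed.

(** Removing [z n] columns replaces [x] by [x + zeta], up to the two rounding errors. *)
Let near_truncn zeta : 0 < zeta ->
  let z n := Num.truncn (zeta * (n%:R * s n)) in
  (\forall n \near \oo, (z n <= m n)%N) /\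
  (\forall n \near \oo,
    `|(m n - z n)%:R - (p^-1 * n%:R - (x + zeta) * (n%:R * s n))| <= 2).
Proof.
move=> zeta0 z.
have near_z : \forall n \near \oo, (z n <= m n)%N.
  near=> n.
  have sn : 0 < s n by near: n.
  have n2 : (2 <= n)%N by near: n; exists 2%N.
  have ns0 : 0 <= n%:R * s n by rewrite mulr_ge0 // ltW.
  (* Makes [(x + zeta) * n * s n] at most half of [p^-1 * n]; the other half is at least 1, which
     covers the rounding of [m n]. *)
  have small : 2 * p * (x + zeta) * s n < 1 by near: n; exact: near_lt1.
  have : `|(m n)%:R - (p^-1 * n%:R - x * (n%:R * s n))| <= 1 by near: n.
  rewrite ler_norml => /andP[h _].
  have /andP[zle _] := truncn_itv (mulr_ge0 (ltW zeta0) ns0).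
  rewrite -(ler_nat R); apply: le_trans zle _.
  have n2' : 2 <= n%:R :> R by rewrite ler_nat.
  have key : n%:R * s n * (x + zeta) <= n%:R * (p^-1 / 2).
    rewrite -mulrA ler_wpM2l // ler_pdivlMr // -[p^-1]mul1r ler_pdivlMr //; lra.
  have pinv : 1 <= p^-1 by rewrite invf_ge1 // ltW.
  have : 1 <= n%:R * (p^-1 / 2) by nra.
  lra.
split=> //; near=> n.
have sn : 0 < s n by near: n.
have ns0 : 0 <= n%:R * s n by rewrite mulr_ge0 // ltW.
have zm : (z n <= m n)%N by near: n.
have : `|(m n)%:R - (p^-1 * n%:R - x * (n%:R * s n))| <= 1 by near: n.
have := truncn_itv (mulr_ge0 (ltW zeta0) ns0); rewrite -/(z n) -natr1.
move=> /andP[z1 z2]; rewrite !ler_norml natrB // => /andP[h1 h2].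
by apply/andP; split; lra.
Unshelve. all: by end_near. Qed.

Lemma lower_tail_limit e : 0 < e ->
  exists2 dl, 0 < dl & \forall n \near \oo,
    expect (bernoulli_field p n (m n)) (fun xi =>
      ((lpp0 xi (m n) n)%:R < n%:R - (c + e) * N n)%R%:R) <= 4 * expR (- dl * N n).
Proof.
move=> e0.
(* Exponents of the terms of [lower_tail] in units of [N n]: [rate2] for the stationary height,
   [rate1] for left exits, [rate3] for late bottom exits, [rate4] and [rate5] for the early bottom
   bits. *)
have rate1 (k t g : R) : 0 < t * g ->
    t * (k - g / 2) + (- t * k + g / 8 * t) <= - (t * g / 4) by lra.
have rate2 (k t g : R) : 0 < t * g ->
    - t * (k - g / 2) + (- - t * (k - g) + g / 8 * t) <= - (t * g / 4) by lra.
have rate3 (k h t g : R) : 0 < t * g -> t * (t * (14 * h)) <= t * (g / 8) ->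
    h * (t + 14 * t ^+ 2) + t * (k - g / 2) + (- t * (k + h) + g / 8 * t) <=
    - (t * g / 4) by lra.
have rate4 (g : R) : 0 < g -> e / 2 - (e + g / 2) <= - (e / 2) by lra.
have rate5 (h k E1 : R) : h * (32 * q * (k + 1) * E1) <= e ->
    h * q * E1 * (k + h) <= h * q * E1 * (k + 1) -> 
    4 * q * h * (k + h) * 4 * E1 <= e / 2 by lra.
pose om1 := p * x / (2 * q).
have om10 : 0 <= om1 by rewrite /om1 divr_ge0 ?mulr_ge0 // ltW.
have px : p * x = 2 * q * om1 by rewrite /om1; field; rewrite gt_eqF.
have cE : c = q * om1 ^+ 2 by rewrite px; field; rewrite gt_eqF.
pose E1 := expR (1 : R); have E10 : 0 < E1 := expR_gt0 1.
(* With [eta * D <= e] the early bottom bits cost at most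
   [16 * q * eta * (om1 + 1) * E1 <= e / 2]. *)
pose D := 32 * q * (om1 + 1) * E1.
have D0 : 0 < D by rewrite /D !mulr_gt0 // ltr_wpDl.
pose eta := Num.min 1 (e / D).
have eta0 : 0 < eta by rewrite lt_min ltr01 divr_gt0.
have eta1 : eta <= 1 by rewrite ge_min lexx.
have etaD : eta * D <= e by rewrite -ler_pdivlMr // ge_min lexx orbT.
(* [om1] is the optimal density scale. At [om0] the stationary deficit is lower
   by [g], whereas exits through the left boundary (bounded with [om1]) and
   bottom exits beyond [zeta * n * s n] (bounded with [om2]) are not better than
   [c]; the bottom bits below [zeta * n * s n] are negligible with [eta]. *)
pose om0 := om1 + eta; pose om2 := om1 + 2 * eta.
have om00 : 0 < om0 by rewrite ltr_wpDl.
have om20 : 0 < om2 by rewrite ltr_wpDl // mulr_gt0.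
(* Makes [om2] the optimal density scale for [x + zeta], since [p * (x + zeta) = 2 * q * om2]. *)
pose zeta := 4 * q * eta / p.
have zeta0 : 0 < zeta by rewrite divr_gt0 // !mulr_gt0.
have pz : p * zeta = 4 * q * eta by rewrite /zeta mulrC divfK // gt_eqF.
pose g := q * eta ^+ 2.
have g0 : 0 < g by rewrite mulr_gt0 // exprn_gt0.
(* The threshold [A] will lie at distance [g / 2] from both deficits [c - g] and [c]. Spending
   [g / 8] on [psi_le] and, for late exits, [g / 8] on the second order in [t] leaves [g / 4]. *)
have e'0 : 0 < g / 8 by rewrite divr_gt0.
have [ta ta0 Ha] := @psi_le om0 x _ (ltW om00) e'0.
have [tb tb0 Hb] := @psi_le om1 x _ om10 e'0.
have [tc tc0 Hc] := @psi_le om2 (x + zeta) _ (ltW om20) e'0.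
(* The coefficient of [t ^ 2] in the cost of the early bits, 14 times [4 * q * eta * om0]. *)
pose F := 56 * q * eta * om0.
have F0 : 0 < F by rewrite /F !mulr_gt0.
(* Besides the three uses of [psi_le], [1 / 2] serves the bounds on [expR t], [eta / (2 * om2)] the
   comparison of sources, and [g / 8 / F] the second-order term. *)
pose t := Num.min (Num.min ta (Num.min tb tc))
  (Num.min (1 / 2) (Num.min (eta / (2 * om2)) (g / 8 / F))).
have t0 : 0 < t by rewrite !lt_min ta0 tb0 tc0 !divr_gt0 ?mulr_gt0.
have tta : t <= ta by rewrite !ge_min lexx.
have ttb : t <= tb by rewrite !ge_min lexx !orbT.
have ttc : t <= tc by rewrite !ge_min lexx !orbT.
have t_half : t <= 1 / 2 by rewrite !ge_min lexx !orbT.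
have t_om : t * (2 * om2) <= eta by rewrite -ler_pdivlMr ?mulr_gt0 // !ge_min lexx !orbT.
have t_F : t * F <= g / 8 by rewrite -ler_pdivlMr // !ge_min lexx !orbT.
have nt : `|t| = t by rewrite gtr0_norm.
pose z n := Num.truncn (zeta * (n%:R * s n)).
have [near_z near_k] := near_truncn zeta0.
have {}Ha := Ha (- t) _ m mE2; rewrite normrN nt t0 tta in Ha; have {}Ha := Ha isT.
have {}Hb := Hb t _ m mE2; rewrite nt t0 ttb in Hb; have {}Hb := Hb isT.
have {}Hc := Hc t _ (fun n => m n - z n)%N near_k.
rewrite nt t0 ttc in Hc; have {}Hc := Hc isT.
have exp_small : \forall n \near \oo, expR (- t) <= 1 - om0 * s n.
  have lt1 : 0 < 1 - expR (- t) by rewrite subr_gt0 expR_lt1 oppr_lt0.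
  have h : om0 * s n @[n --> \oo] --> om0 * 0 by apply: cvgM => //; exact: cvg_cst.
  rewrite mulr0 in h; have := cvgr_lt _ h _ lt1 => /(_ _).
  by apply: filterS => n h'; rewrite lerBrDr addrC -lerBrDr ltW.
exists (Num.min (t * g / 4) (e / 2)).
  by rewrite lt_min !divr_gt0 // mulr_gt0.
near=> n.
have sn : 0 < s n by near: n.
have N0 : 0 <= N n by rewrite mulr_ge0 // sqr_ge0.
have ns0 : 0 <= n%:R * s n by rewrite mulr_ge0 // ltW.
have zm : (z n <= m n)%N by near: n.
have w10 : 0 <= om1 * s n by rewrite mulr_ge0 // ltW.
have w1le : om1 * s n <= om0 * s n by rewrite ler_wpM2r ?(ltW sn) // lerDl ltW.
have w02le : om0 * s n <= om2 * s n.
  by rewrite ler_wpM2r ?(ltW sn) // lerD2l ler_peMl ?ltW // ltr1n.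
have w2lt : om2 * s n < 1 by near: n; exact: near_lt1.
have w00 : 0 <= om0 * s n := le_trans w10 w1le.
have w0lt : om0 * s n < 1 := le_lt_trans w02le w2lt.
have w2itv : 0 <= om2 * s n < 1 by rewrite (le_trans w00 w02le).
pose A := n%:R - (c - g / 2) * N n.
pose B := (e + g / 2) * N n.
have -> : n%:R - (c + e) * N n = A - B by rewrite /A /B; ring.
have src : source p (om0 * s n) (- t) <= source p (om2 * s n) t.
  apply: source_le => //.
  rewrite mulrAC [leRHS]mulrAC ler_wpM2r ?(ltW sn) //.
  apply: mul_expR_le; [exact: ltW|exact: ltW|exact: t_half|].
  by have -> : om2 - om0 = eta by rewrite /om2 /om0; ring.
have u0le : source p (om0 * s n) (- t) <= p * (om0 * s n) * expR t ^+ 2.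
  by apply: source_ub => //; [exact: ltW | near: n; exact: exp_small].
have zle : (z n)%:R <= zeta * (n%:R * s n).
  by have /andP[] := truncn_itv (mulr_ge0 (ltW zeta0) ns0).
have zu : (z n)%:R * source p (om0 * s n) (- t) <=
    N n * (4 * q * eta * om0 * expR t ^+ 2).
  have [u0 _] := andP (source_itv p0 (- t) (introT andP (conj w00 w0lt))).
  apply: le_trans (ler_pM _ _ zle u0le) _ => //.
  by rewrite -pz le_eqVlt; apply/orP; left; apply/eqP; ring.
have := lower_tail p0 p1 A B (z n) (m n - z n) n w10 w1le w0lt w2itv (ltW t0) src.
rewrite subnKC // => tail; apply: le_trans tail _.
have tth : 0 <= t <= 1 / 2 by rewrite ltW.
pose dl := Num.min (t * g / 4) (e / 2); rewrite -/dl.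
have bound y k : dl <= k -> y <= N n * - k -> expR y <= expR (- dl * N n).
  move=> dlk h; rewrite ler_expR; apply: le_trans h _.
  by rewrite (mulrC (- dl)) ler_wpM2l // lerN2.
have min1 : dl <= t * g / 4 by rewrite ge_min lexx.
have min2 : dl <= e / 2 by rewrite ge_min lexx orbT.
have tg0 : 0 < t * g by rewrite mulr_gt0.
have -> : 4 * expR (- dl * N n) = expR (- dl * N n) +
  (expR (- dl * N n) + (expR (- dl * N n) + expR (- dl * N n))) by ring.
have nA : n%:R - A = N n * (c - g / 2) by rewrite /A; ring.
apply: lerD; [|apply: lerD; [|apply: lerD]];
  [apply: (bound _ _ min1)..|apply: (bound _ _ min2)].
- have h : psi p (om0 * s n) (- t) (m n) n <=
    N n * (- - t * (p * x * om0 - (1 - p) * om0 ^+ 2) + g / 8 * t) by near: n; exact: Ha.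
  rewrite nA mulrCA; apply: le_trans (lerD (lexx _) h) _; rewrite -mulrDr ler_wpM2l //.
  have -> : p * x * om0 - (1 - p) * om0 ^+ 2 = c - g by rewrite cE px /om0 /g; ring.
  exact: rate2.
- have h : psi p (om1 * s n) t (m n) n <=
    N n * (- t * (p * x * om1 - (1 - p) * om1 ^+ 2) + g / 8 * t) by near: n; exact: Hb.
  rewrite nA mulrCA; apply: le_trans (lerD (lexx _) h) _; rewrite -mulrDr ler_wpM2l //.
  have -> : p * x * om1 - (1 - p) * om1 ^+ 2 = c by rewrite cE px; ring.
  exact: rate1.
- have h : psi p (om2 * s n) t (m n - z n) n <=
    N n * (- t * (p * (x + zeta) * om2 - (1 - p) * om2 ^+ 2) + g / 8 * t)
    by near: n; exact: Hc.
  have et0 : 0 <= expR t - 1 by rewrite subr_ge0; apply: le_trans (expR_ge1Dx t); rewrite lerDl ltW.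
  have h2 : (z n)%:R * source p (om0 * s n) (- t) * (expR t - 1) <=
      N n * (4 * q * eta * om0 * (t + 14 * t ^+ 2)).
    apply: le_trans (ler_wpM2r et0 zu) _.
    rewrite -(mulrA (N n)) ler_wpM2l // -(mulrA _ (_ ^+ 2)) ler_wpM2l //; last exact: expR_cubic.
    by rewrite !mulr_ge0 // ltW.
  rewrite nA (mulrCA t); apply: le_trans (lerD (lerD h2 (lexx _)) h) _.
  rewrite -!mulrDr ler_wpM2l //.
  (* The excess [4 * q * eta * om0] over [c] cancels the first-order cost of the bottom bits before
     [z n]. *)
  have -> : p * (x + zeta) * om2 - (1 - p) * om2 ^+ 2 = c + 4 * q * eta * om0.
    by rewrite cE (mulrDr p) px pz /om2 /om0; ring.
  apply: rate3 => //; rewrite (_ : 14 * _ = F); last by rewrite /F; ring.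
  by rewrite ler_wpM2l // ltW.
- have et4 : expR t ^+ 2 <= 4.
    rewrite (_ : 4 = 2 ^+ 2); last by ring.
    by rewrite lerXn2r ?nnegrE ?expR_ge0 // expR_half.
  have E1ge : 0 <= expR 1 - 1 :> R.
    by rewrite subr_ge0; apply: le_trans (expR_ge1Dx 1); rewrite lerDl.
  apply: (@le_trans _ _ (N n * (e / 2) - B)); last first.
    rewrite /B (mulrC _ (N n)) -mulrBr ler_wpM2l //; exact: rate4.
  rewrite lerD2r; apply: le_trans (ler_wpM2r E1ge zu) _.
  rewrite -(mulrA (N n)) ler_wpM2l //.
  apply: (@le_trans _ _ (4 * q * eta * om0 * 4 * E1)).
    apply: ler_pM => //; last by rewrite /E1 lerBlDr lerDl.
      by rewrite !mulr_ge0 ?sqr_ge0 ?(ltW q0) ?(ltW eta0) ?(ltW om00).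
    by rewrite ler_wpM2l // !mulr_ge0 ?(ltW q0) ?(ltW eta0) ?(ltW om00).
  have : eta * q * E1 * om0 <= eta * q * E1 * (om1 + 1).
    by rewrite ler_wpM2l ?lerD2l // !mulr_ge0 ?(ltW q0) ?(ltW eta0) ?(ltW E10).
  by rewrite /D in etaD; apply: rate5.
Unshelve. all: by end_near. Qed.

End asymptotics.

(** * Powers of [n] and convergence in probability *)

Lemma cvg_powR_pinfty (R : realType) (b : R) : 0 < b ->
  n%:R `^ b @[n --> \oo] --> +oo.
Proof.
move=> b0; apply/cvgryPge => A; near=> n.
apply: le_trans (ler_norm A) _.
have -> : `|A| = (`|A| `^ b^-1) `^ b by rewrite -powRrM mulVf ?gt_eqF // powRr1.
apply: ge0_ler_powR; rewrite ?nnegrE ?powR_ge0 ?(ltW b0) //.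
apply: le_trans (ltW (truncnS_gt _)) _; rewrite ler_nat.
near: n; exact: nbhs_infty_ge.
Unshelve. all: by end_near. Qed.

Lemma cvg_powR_inv (R : realType) (b : R) : 0 < b ->
  (n%:R `^ b)^-1 @[n --> \oo] --> 0.
Proof.
move=> b0; apply/gtr0_cvgV0; last exact: cvg_powR_pinfty.
by near=> n; rewrite powR_gt0 // ltr0n; near: n; exists 1%N.
Unshelve. all: by end_near. Qed.

Lemma deviation_split (R : realType) (e c N n l : R) : 0 < N ->
  (e < `|(n - l) / N - c|)%R%:R <=
  (n - (c - e) * N <= l)%R%:R + (l < n - (c + e) * N)%R%:R :> R.
Proof.
move=> N0; case: (ltP e) => [|_]; last by rewrite addr_ge0.
have [h2|_] := leP (n - (c + e) * N) l; last by rewrite lerDr.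
have [_|h1] := leP (n - (c - e) * N) l; first by rewrite lerDl.
rewrite ltNge => /negP[]; rewrite ler_norml; apply/andP; split.
  by rewrite lerBrDl ler_pdivlMr //; lra.
by rewrite lerBlDl ler_pdivrMr //; lra.
Qed.

Theorem theorem2p2 (R : realType) (d : measure_display) (T : measurableType d)
    (P : probability T R) (p q a x : R) (X : int * int -> {RV P >-> R})
    (hp0 : 0 < p) (hp1 : p < 1) (hq : q = 1 - p)
    (ha0 : 1 / 2 < a) (ha1 : a < 1) (hx : 0 <= x)
    (hX1 : forall v, P [set w | X v w = 1] = p%:E)
    (hX0 : forall v, P [set w | X v w = 0] = q%:E)
    (hXind : mutually_independent X) :
  cvg_in_probability P
    (fun (n : nat) (w : T) =>
       (n%:R - (L (fun v => X v w == 1)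
                  (Num.floor (p^-1 * n%:R - x * n%:R `^ a)) n%:Z)%:R)
       / n%:R `^ (2 * a - 1))
    ((p * x) ^+ 2 / (4 * q)).
Proof.
move=> e e0.
pose s n : R := n%:R `^ (a - 1).
pose m n := `|Num.floor (p^-1 * n%:R - x * n%:R `^ a)|%N.
have n_gt0 : \forall n \near \oo, (0 < n)%N by exists 1%N.
have s_gt0 : \forall n \near \oo, 0 < s n.
  by apply: filterS n_gt0 => n n0; rewrite powR_gt0 // ltr0n.
have nsE n : (0 < n)%N -> n%:R * s n = n%:R `^ a.
  by move=> n0; rewrite /s mulr_powRB1 //; lra.
have NE n : (0 < n)%N -> n%:R * s n ^+ 2 = n%:R `^ (2 * a - 1).
  move=> n0; rewrite expr2 mulrA nsE // /s -powRD; last by rewrite pnatr_eq0 -lt0n n0 implybT.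
  by congr (_ `^ _); ring.
have s_to0 : s n @[n --> \oo] --> 0.
  have h : 0 < 1 - a by lra.
  have := cvg_powR_inv h; apply: cvg_trans; apply: near_eq_cvg.
  apply: filterS n_gt0 => n n0; rewrite /s -powRN opprB //.
have ns_inv : (n%:R * s n)^-1 @[n --> \oo] --> 0.
  have h : 0 < a by lra.
  have := cvg_powR_inv h; apply: cvg_trans; apply: near_eq_cvg.
  by apply: filterS n_gt0 => n n0; rewrite nsE.
have N_inv : (n%:R * s n ^+ 2)^-1 @[n --> \oo] --> 0.
  have h : 0 < 2 * a - 1 by lra.
  have := cvg_powR_inv h; apply: cvg_trans; apply: near_eq_cvg.
  by apply: filterS n_gt0 => n n0; rewrite NE.
(* Eventually the floor is a natural number, so the absolute value in [m] does not change it. *)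
have floor_ge0 : \forall n \near \oo, 0 <= p^-1 * n%:R - x * n%:R `^ a.
  have h : p * x * s n @[n --> \oo] --> p * x * 0.
    by apply: cvgM => //; exact: cvg_cst.
  rewrite mulr0 in h; have small := cvgr_lt _ h _ ltr01.
  near=> n.
  have n0 : (0 < n)%N by near: n.
  have lt1 : p * x * s n < 1 by near: n; exact: small.
  rewrite -nsE // mulrCA (mulrC p^-1) -mulrBr mulr_ge0 //.
  by rewrite subr_ge0 -[p^-1]mul1r ler_pdivlMr // mulrC mulrA ltW.
have floorE : \forall n \near \oo,
    Num.floor (p^-1 * n%:R - x * n%:R `^ a) = (m n)%:Z.
  by apply: filterS floor_ge0 => n n0; rewrite /m gez0_abs // floor_ge0.
have mE : \forall n \near \oo,
    `|(m n)%:R - (p^-1 * n%:R - x * (n%:R * s n))| <= 1.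
  near=> n; rewrite nsE; last by near: n.
  have fE : Num.floor (p^-1 * n%:R - x * n%:R `^ a) = (m n)%:Z by near: n.
  have := floor_itv (p^-1 * n%:R - x * n%:R `^ a).
  rewrite fE intrD => /andP[h1 h2]; rewrite ler_norml.
  by apply/andP; split; [move: h2|move: h1]; rewrite -pmulrn; lra.
have [d1 d10 up] := upper_tail_limit hp0 hp1 s_gt0 s_to0 ns_inv hx mE e0.
have [d2 d20 lo] := lower_tail_limit hp0 hp1 s_gt0 s_to0 ns_inv hx mE e0.
rewrite hq.
apply: (@squeeze_cvge _ _ _ _ (fun=> 0%E) _
  (fun n => ((d1^-1 + 4 * d2^-1) * (n%:R * s n ^+ 2)^-1)%:E)).
- near=> n; apply/andP; split; first exact: measure_ge0.
  have n0 : (0 < n)%N by near: n.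
  have sn : 0 < s n by near: n.
  have N0 : 0 < n%:R * s n ^+ 2 by rewrite mulr_gt0 ?ltr0n ?exprn_gt0.
  have fE : Num.floor (p^-1 * n%:R - x * n%:R `^ a) = (m n)%:Z by near: n.
  rewrite fE -NE // (probability_lpp hX1 hXind (fun k =>
    e < `|(n%:R - k%:R) / (n%:R * s n ^+ 2) - (p * x) ^+ 2 / (4 * (1 - p))|)); last by rewrite !ltW.
  rewrite lee_fin.
  apply: (@le_trans _ _ (expR (- d1 * (n%:R * s n ^+ 2)) + 4 * expR (- d2 * (n%:R * s n ^+ 2)))).
    have upn : expect (bernoulli_field p n (m n)) (fun xi =>
        (n%:R - ((p * x) ^+ 2 / (4 * (1 - p)) - e) * (n%:R * s n ^+ 2) <=
         (lpp (fun=> 0%N) (fun=> 0%N) xi (m n) n)%:R)%R%:R) <=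
        expR (- d1 * (n%:R * s n ^+ 2)) by near: n; exact: up.
    have lon : expect (bernoulli_field p n (m n)) (fun xi =>
        ((lpp (fun=> 0%N) (fun=> 0%N) xi (m n) n)%:R <
         n%:R - ((p * x) ^+ 2 / (4 * (1 - p)) + e) * (n%:R * s n ^+ 2))%R%:R) <=
        4 * expR (- d2 * (n%:R * s n ^+ 2)) by near: n; exact: lo.
    apply: le_trans (lerD upn lon).
    rewrite -expectD; apply: le_expect => [|xi]; first exact: bernoulli_field_dist.
    by apply: deviation_split.
  (* The crude bound [expR (- y) <= y^-1] suffices, because [n * s n ^ 2] tends to infinity. *)
  have expV dl : 0 < dl -> expR (- dl * (n%:R * s n ^+ 2)) <= dl^-1 * (n%:R * s n ^+ 2)^-1.
    move=> dl0; have dN : 0 < dl * (n%:R * s n ^+ 2) by rewrite mulr_gt0.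
    rewrite mulNr expRN -invfM lef_pV2 ?posrE ?expR_gt0 ?dN //.
    by apply: le_trans (expR_ge1Dx _); rewrite lerDr.
  have four : 0 <= 4 :> R by [].
  apply: le_trans (lerD (expV _ d10) (ler_wpM2l four (expV _ d20))) _.
  by rewrite le_eqVlt; apply/orP; left; apply/eqP => /=; ring.
- exact: cvg_cst.
- apply: cvg_EFin; first by near=> n.
  rewrite -[0]/(0 : R) -(mulr0 (d1^-1 + 4 * d2^-1)).
  by apply: cvgM => //; exact: cvg_cst.
Unshelve. all: by end_near. Qed.
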